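(* Let $m\ge2$ be an integer and set $$p_m:=\frac{2m}{\log_2\binom{2m}{m}}.$$ Let $d\ge1$ be an integer. For $E\subseteq\{0,1\}^d$ and $0\le r<1$, define $$\mu_{E,r}(\xi):=\sum_{k=0}^{\lfloor |E|/2\rfloor}r^{2k}N_{E,k}(\xi),\qquad \xi\in\mathbb{Z}^d.$$ Then $$\int_{\mathbb{T}^d}\left(\left|\sum_{\xi\in\mathbb{Z}^d}\mu_{E,r}(\xi)e^{-2\pi i\xi\cdot t}\right|^2-(1-r^2)^{|E|}\right)^m\,\mathrm{d}t\le C_{m,|E|}(r)\,|E|^{2m/p_m},$$ where $$C_{m,n}(r):=(1-r^2)^{mn}\left(\frac{\left(\frac{1+r}{1-r}\right)^n-1}{\log\left(\left(\frac{1+r}{1-r}\right)^n\right)}\,\log\frac1{1-r^2}\right)^m,$$ and when both the numerator and the denominator in the fraction vanish, the fraction is interpreted as $1$.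
   Context: $\mathbb{T}=\mathbb{R}/\mathbb{Z}$ with normalized Haar measure, $\mathbb{T}^d$ with the product measure; $\log$ is the natural logarithm. The set $\{0,1\}^d$ is ordered lexicographically (strict order $<$) and regarded as a subset of $\mathbb{Z}^d$. For $\xi=(\xi_1,\dots,\xi_d)\in\mathbb{Z}^d$ and $t=(t_1,\dots,t_d)\in\mathbb{T}^d$, the pairing is reversed: $\xi\cdot t:=\xi_1t_d+\xi_2t_{d-1}+\cdots+\xi_dt_1$. For $k\ge0$ and $\xi\in\mathbb{Z}^d$, $$N_{E,k}(\xi):=\#\Bigl\{(\omega_1,\dots,\omega_{2k})\in E^{2k}:\ \omega_1<\cdots<\omega_{2k},\ \omega_2-\omega_1+\omega_4-\omega_3+\cdots+\omega_{2k}-\omega_{2k-1}=\xi\Bigr\},$$ with $N_{E,0}(0)=1$ and $N_{E,0}(\xi)=0$ for $\xi\ne0$; the differences are taken in $\mathbb{Z}^d$. *)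

(* Defs.v *)
From HB Require Import structures.
From mathcomp Require Import all_boot all_order all_algebra.
From mathcomp Require Import all_classical all_reals all_analysis.
From mathcomp Require Import complex.

Set Implicit Arguments.
Unset Strict Implicit.
Unset Printing Implicit Defensive.

Import Order.TTheory GRing.Theory Num.Theory.
Import numFieldNormedType.Exports.

Local Open Scope ring_scope.

(* {0,1}^d, with false = 0, true = 1 and the lexicographic order. *)
Definition cube (d : nat) := d.-tuplelexi bool.

Definition cube_vec d (w : cube d) : 'rV[int]_d := \row_j (tnth w j : nat)%:Z.

(* Indices start at 0, so the terms w_1, w_3, ... get the sign - and w_2, w_4,
   ... the sign +. *)
Definition altsum d n (w : n.-tuple (cube d)) : 'rV[int]_d :=
  \sum_(i < n) (-1) ^+ i.+1 *: cube_vec (tnth w i).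

Definition Ncount d (E : {set cube d}) (k : nat) (xi : 'rV[int]_d) : nat :=
  #|[pred w : (2 * k).-tuple (cube d) |
      [&& all (fun x => x \in E) w, sorted <%O w & altsum w == xi]]|.

Definition mucoef (R : realType) d (E : {set cube d}) (r : R)
    (xi : 'rV[int]_d) : R :=
  \sum_(k < (#|E| %/ 2).+1) r ^+ (2 * k) * (Ncount E k xi)%:R.

(* The pairing of Z^d with R^d that reverses the coordinates of t. *)
Definition pairing (R : realType) d (xi : 'rV[int]_d) (t : d.-tuple R) : R :=
  \sum_(j < d) (xi ord0 j)%:~R * tnth t (rev_ord j).

(* exp (- 2 pi i x) *)
Definition expm2pi (R : realType) (x : R) : R[i] :=
  Complex (cos (2 * pi * x)) (- sin (2 * pi * x)).

Section torus_measure.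
Context (R : realType).

Definition tcons n (x : measurableTypeR R * n.-tuple (measurableTypeR R)) :
    n.+1.-tuple (measurableTypeR R) :=
  [the n.+1.-tuple _ of x.1 :: x.2].

Lemma measurable_tcons n : measurable_fun setT (@tcons n).
Proof. exact: measurable_cons. Qed.

HB.instance Definition _ n :=
  isMeasurableFun.Build _ _ _ _ (@tcons n) (@measurable_tcons n).

(* A point of the torus (R/Z)^d is represented by real coordinates, and the
   normalized Haar measure of R/Z by the uniform probability on its fundamental
   domain [0, 1]. The torus measure is the d-fold product, transported from
   R * R^n to R^(n+1). *)
Fixpoint torus_measure (d : nat) :
    probability (d.-tuple (measurableTypeR R)) R :=
  match d with
  | 0 => dirac [tuple]
  | n.+1 =>
      distribution (uniform_prob (@ltr01 R) \x torus_measure n)%E (@tcons n)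
  end.

End torus_measure.

(* The sum over Z^d is a finitely supported one. *)
Definition mu_transform (R : realType) d (E : {set cube d}) (r : R)
    (t : d.-tuple R) : R[i] :=
  \sum_(xi \in [set: 'rV[int]_d]%classic)
     real_complex R (mucoef E r xi) * expm2pi (pairing xi t).

Definition log2 (R : realType) (x : R) : R := ln x / ln 2.

Definition pexp (R : realType) (m : nat) : R :=
  (2 * m)%:R / log2 ('C(2 * m, m))%:R.

(* The quotient a / b, read as 1 when both terms vanish. *)
Definition quot01 (R : realType) (a b : R) : R :=
  if (a == 0) && (b == 0) then 1 else a / b.

Definition Cconst (R : realType) (m n : nat) (r : R) : R :=
  let q := ((1 + r) / (1 - r)) ^+ n in
  (1 - r ^+ 2) ^+ (m * n) *
    (quot01 (q - 1) (ln q) * ln (1 / (1 - r ^+ 2))) ^+ m.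

(* Main.v *)
Require Import Defs.
From HB Require Import structures.
From mathcomp Require Import all_boot all_order all_algebra.
From mathcomp Require Import all_classical all_reals all_analysis.
From mathcomp Require Import measurable_realfun complex ring lra zify.

(* Attach to each w in E the matrix [[1, r y_w], [r conj y_w, 1]] of determinant
   1 - r^2, where y_w = exp (2 pi i w.t). Expanding the product of these matrices
   in lexicographic order shows that its upper left entry a is the transform of
   mu. Put u = ln (|a|^2 / (1 - r^2)^|E|) >= 0. Since
   |a|^2 <= (1 + r)^(2 |E|), convexity of exp bounds e^u - 1 by a multiple of u,
   and it remains to bound the integral of u^m by L^m |E|^kappa, where
   L = ln (1 / (1 - r^2)) and kappa = log2 'C(2m, m).
   The lexicographic order makes the product a binary tree in which two
   neighbouring subproducts, with values A and B of u, are merged with a relative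
   phase given by one coordinate of t. The merged value is
   A + B + ln |1 + rho e^(i theta)|^2, where the logarithm has mean 0 and
   rho^2 = (1 - e^-A) (1 - e^-B). Its m-th moment in theta is at most that of
   A + B + 2 sqrt (A B) cos theta = |sqrt A + sqrt B e^(i theta)|^2, because the
   two functions cross once, and the latter moment is
   sum_j 'C(m, j)^2 A^j B^(m - j). A two-point inequality bounds this sum by
   (A^(m/kappa) + B^(m/kappa))^kappa, which by convexity of x^kappa splits into a
   weighted sum of A^m and B^m, with weights determined by the numbers of points
   of E below the two nodes; this sum can be iterated along the tree. *)

Set Implicit Arguments.
Unset Strict Implicit.
Unset Printing Implicit Defensive.

Import Order.TTheory GRing.Theory Num.Theory.
Import numFieldNormedType.Exports.
Local Open Scope classical_set_scope.
Local Open Scope ring_scope.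

(** * The two-point inequality *)

Section legendre.
Context {R : realType}.
Implicit Types (s x : R) (m : nat).

Let bsq m j : R := ('C(m, j) ^ 2)%:R.
Let frq m j : R := (2 * j)%:R - m%:R.

(** The index [w] counts derivatives in [s]. For [w = 0] this is [bin_form m A B] divided by
    (AB)^(m/2), where A/B = e^(2s). *)
Definition legendre_sum m (w : nat) s : R :=
  \sum_(j < m.+1) (bsq m j * frq m j ^+ w) * expR (frq m j * s).

Lemma is_derive_expM (k s : R) :
  is_derive s 1 (fun x : R => expR (k * x)) (k * expR (k * s)).
Proof.
have -> : (fun x : R => expR (k * x)) = expR \o ( *:%R k) by [].
apply: is_derive_eq.
by rewrite scaler1 /GRing.scale /= mulrC.
Qed.

Lemma is_derive_legendre_sum m w s : is_derive s 1 (legendre_sum m w) (legendre_sum m w.+1 s).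
Proof.
rewrite /legendre_sum.
have -> : (fun x : R => \sum_(j < m.+1) bsq m j * frq m j ^+ w * expR (frq m j * x)) =
  \sum_(j < m.+1) (fun x : R => bsq m j * frq m j ^+ w * expR (frq m j * x)).
  by apply/funext => x; rewrite fct_sumE.
have H (j : 'I_m.+1) : is_derive s 1
    (fun x : R => bsq m j * frq m j ^+ w * expR (frq m j * x))
    (bsq m j * frq m j ^+ w.+1 * expR (frq m j * s)).
  have He := is_derive_expM (frq m j) s.
  have := is_deriveZ (bsq m j * frq m j ^+ w) He.
  by rewrite /GRing.scale /= mulrA exprSr !mulrA.
exact: is_derive_sum.
Qed.

Lemma legendre_sum_ge m s : expR (m%:R * s) <= legendre_sum m 0 s.
Proof.
rewrite /legendre_sum big_ord_recr /= expr0 mulr1 /bsq binn exp1n mul1r.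
have -> : frq m m = m%:R by rewrite /frq natrM; ring.
rewrite lerDr sumr_ge0// => j _.
by rewrite expr0 mulr1 mulr_ge0 ?expR_ge0 ?ler0n.
Qed.

Lemma legendre_sum_gt0 m s : 0 < legendre_sum m 0 s.
Proof. exact: lt_le_trans (expR_gt0 _) (legendre_sum_ge m s). Qed.

Lemma sum_bin_sq m : (\sum_(j < m.+1) 'C(m, j) ^ 2 = 'C(2 * m, m))%N.
Proof.
rewrite mul2n -addnn -(binomial.Vandermonde m m m).
apply: eq_bigr => j _; rewrite expnS expn1 bin_sub //.
by rewrite -ltnS.
Qed.

Lemma legendre_sum00 m : legendre_sum m 0 0 = ('C(2 * m, m))%:R.
Proof.
rewrite -sum_bin_sq natr_sum; apply: eq_bigr => j _.
by rewrite mulr0 expR0 expr0 !mulr1.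
Qed.

(** The top frequency m has coefficient 1, all others are at most m - 2, and the coefficients add up
    to 'C(2m, m). *)
Lemma legendre_sum_le m s : 0 <= s ->
  legendre_sum m 0 s <= expR (m%:R * s) * (1 + ('C(2 * m, m))%:R * expR (- (2 * s))).
Proof.
move=> s0; rewrite mulrDr mulr1 /legendre_sum big_ord_recr /= expr0 mulr1 /bsq binn exp1n mul1r.
have -> : frq m m = m%:R by rewrite /frq natrM; ring.
rewrite addrC lerD2l mulrCA -expRD -sum_bin_sq natr_sum mulr_suml.
rewrite [leRHS]big_ord_recr /= ler_wpDr ?mulr_ge0 ?expR_ge0//.
apply: ler_sum => j _; rewrite expr0 mulr1 ler_wpM2l// ler_expR /frq.
have hj : (j : nat)%:R + 1 <= m%:R :> R by rewrite -[1]/(1%:R) -natrD ler_nat addn1.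
rewrite natrM.
nra.
Qed.

(* This is Legendre's equation: [legendre_sum m 0 s] equals
   [(expR s - expR (- s)) ^+ m] times the Legendre polynomial at [coth s]. *)
Lemma legendre_sum_ode m s :
  (expR s - expR (- s)) * legendre_sum m 2 s =
  2 * m%:R * (expR s + expR (- s)) * legendre_sum m 1 s
  - m%:R ^+ 2 * (expR s - expR (- s)) * legendre_sum m 0 s.
Proof.
apply/eqP; rewrite -subr_eq0; apply/eqP.
rewrite /legendre_sum !mulr_sumr -!sumrB.
(* The factors e^s and e^(-s) move each frequency up or down by 1, so the summand becomes
   [g j.+1 - g j], by (j+1) 'C(m, j+1) = (m-j) 'C(m, j). The sum telescopes, and [g] vanishes at
   both ends. *)
pose g j : R := (2 * ('C(m, j) * j)%:R) ^+ 2 * expR ((frq m j - 1) * s).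
transitivity (\sum_(j < m.+1) (g j.+1 - g j)).
  have alg (c x y E a b : R) : (a - b) * ((c ^+ 2 * (2 * x - y) ^+ 2) * E) -
      (2 * y * (a + b) * ((c ^+ 2 * (2 * x - y) ^+ 1) * E) -
       y ^+ 2 * (a - b) * ((c ^+ 2 * (2 * x - y) ^+ 0) * E)) =
      (2 * (c * (y - x))) ^+ 2 * (E * a) - (2 * (c * x)) ^+ 2 * (E * b).
    by rewrite !expr0 !expr1; ring.
  apply: eq_bigr => j _; rewrite /g.
  have -> : ('C(m, j.+1) * j.+1 = 'C(m, j) * (m - j))%N.
    by rewrite [LHS]mulnC mul_bin_left mulnC.
  have jm : (j <= m)%N by rewrite -ltnS.
  have -> : (frq m j.+1 - 1) * s = frq m j * s + s.
    by rewrite /frq -[j.+1]addn1 mulnDr natrD; ring.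
  have -> : (frq m j - 1) * s = frq m j * s - s by ring.
  rewrite !expRD /bsq natrX !natrM natrB// /frq natrM.
  exact: alg.
rewrite -(big_mkord xpredT (fun j => g j.+1 - g j)) telescope_sumr //.
by rewrite /g bin_small// mul0n muln0 !mulr0 expr0n !mul0r subrr.
Qed.

Section parameters.
Context (m : nat) (m2 : (2 <= m)%N).

(** This exponent turns the two-point inequality into an equality at A = B, where both sides are
    'C(2m, m) A^m. *)
Definition kappa : R := ln ('C(2 * m, m))%:R / ln 2.

Lemma bin2m_ge : (2 ^ m <= 'C(2 * m, m))%N.
Proof.
rewrite -sum_bin_sq -[2%N]/(1 + 1)%N Pascal; apply: leq_sum => j _.
by rewrite !exp1n !muln1 expnS expn1 leq_pmulr// bin_gt0 -ltnS.
Qed.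

Lemma bin2m_lt : ('C(2 * m, m) < 2 ^ (2 * m))%N.
Proof.
rewrite -[X in (X ^ _)%N]/(1 + 1)%N Pascal.
have mm : (m < (2 * m).+1)%N by lia.
rewrite (bigD1 (Ordinal mm)) //= !exp1n !muln1.
have oo : (0 < (2 * m).+1)%N by lia.
rewrite (bigD1 (Ordinal oo)) /=; last by rewrite -val_eqE /=; lia.
by rewrite bin0 !exp1n !muln1; lia.
Qed.

Let ln2_gt0 : 0 < ln (2 : R).
Proof. by rewrite ln_gt0// ltr1n. Qed.

Lemma kappaE : kappa * ln 2 = ln ('C(2 * m, m))%:R.
Proof. by rewrite /kappa divfK// gt_eqF. Qed.

(** Together with [kappa_lt] this places 2m/kappa - 1 in the interval (0, 1] required by
    [dsinh_ratio]. *)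
Lemma kappa_ge : m%:R <= kappa.
Proof.
rewrite /kappa ler_pdivlMr// mulr_natl -lnXn ?ltr0n//.
by rewrite ler_ln ?posrE ?exprn_gt0 ?ltr0n// -?natrX ?ler_nat ?bin2m_ge// bin_gt0; lia.
Qed.

Lemma kappa_lt : kappa < 2 * m%:R.
Proof.
rewrite /kappa ltr_pdivrMr// -natrM mulr_natl -lnXn ?ltr0n//.
by rewrite ltr_ln ?posrE ?exprn_gt0 ?ltr0n// -?natrX ?ltr_nat ?bin2m_lt// bin_gt0; lia.
Qed.

Lemma kappa_gt1 : 1 < kappa.
Proof. by apply: lt_le_trans kappa_ge; rewrite ltr1n. Qed.

Definition qexp : R := m%:R / kappa.
End parameters.

(** * Derivative rules and hyperbolic functions *)

Lemma MVT_closed (f df : R -> R) (a b : R) : a < b ->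
  (forall x, a <= x <= b -> is_derive x 1 f (df x)) ->
  exists2 c, a < c < b & f b - f a = df c * (b - a).
Proof.
move=> ab fdf.
have [|||c ci ->] := @MVT R f df a b => //.
- by move=> x; rewrite in_itv /= => /andP[/ltW ax /ltW xb]; apply: fdf; rewrite ax.
- apply: derivable_within_continuous => x; rewrite in_itv /= => xab.
  by have [] := fdf x xab.
- by exists c => //; move: ci; rewrite in_itv.
Qed.

(** [dsinh] and [dcosh] are 2 sinh and 2 cosh; without the factor 1/2 they are the exponential sums
    that occur below. *)
Definition dsinh x : R := expR x - expR (- x).
Definition dcosh x : R := expR x + expR (- x).

Lemma is_derive_dsinhM (k s : R) :
  is_derive s 1 (fun x : R => dsinh (k * x)) (k * dcosh (k * s)).
Proof.
have -> : (fun x : R => dsinh (k * x)) =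
    (fun x => expR (k * x)) - (fun x => expR (- k * x)).
  by apply/funext => x; rewrite /dsinh -mulNr.
apply: (is_derive_eq (is_deriveB (is_derive_expM k s) (is_derive_expM (- k) s))).
by rewrite /dcosh !mulNr; ring.
Qed.

Lemma is_derive_dcoshM (k s : R) :
  is_derive s 1 (fun x : R => dcosh (k * x)) (k * dsinh (k * s)).
Proof.
have -> : (fun x : R => dcosh (k * x)) =
    (fun x => expR (k * x)) + (fun x => expR (- k * x)).
  by apply/funext => x; rewrite /dcosh -mulNr.
apply: (is_derive_eq (is_deriveD (is_derive_expM k s) (is_derive_expM (- k) s))).
by rewrite /dsinh !mulNr; ring.
Qed.

Lemma is_derive_dsinh (s : R) : is_derive s 1 dsinh (dcosh s).
Proof.
have := is_derive_dsinhM 1 s.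
by under eq_fun do rewrite mul1r; rewrite !mul1r.
Qed.

Lemma is_derive_dcosh (s : R) : is_derive s 1 dcosh (dsinh s).
Proof.
have := is_derive_dcoshM 1 s.
by under eq_fun do rewrite mul1r; rewrite !mul1r.
Qed.

Lemma dsinh_gt0 s : 0 < s -> 0 < dsinh s.
Proof. by move=> s0; rewrite subr_gt0 ltr_expR; lra. Qed.

Lemma dsinh0 : dsinh 0 = 0. Proof. by rewrite /dsinh oppr0 subrr. Qed.

Lemma dcosh_gt0 s : 0 < dcosh s.
Proof. by rewrite addr_gt0 ?expR_gt0. Qed.

Lemma is_derive_mul (f g : R -> R) x (df dg : R) :
  is_derive x 1 f df -> is_derive x 1 g dg ->
  is_derive x 1 (fun y => f y * g y) (df * g x + f x * dg).
Proof.
move=> hf hg; have -> : (fun y => f y * g y) = f * g by [].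
apply: (is_derive_eq (is_deriveM hf hg)).
by rewrite /GRing.scale /=; ring.
Qed.

Lemma is_derive_sub (f g : R -> R) x (df dg : R) :
  is_derive x 1 f df -> is_derive x 1 g dg ->
  is_derive x 1 (fun y => f y - g y) (df - dg).
Proof. by move=> hf hg; exact: (is_deriveB hf hg). Qed.

Lemma is_derive_inv (f : R -> R) x (df : R) :
  f x != 0 -> is_derive x 1 f df ->
  is_derive x 1 (fun y => (f y)^-1) (- df / f x ^+ 2).
Proof.
move=> f0 hf; apply: (is_derive_eq (is_deriveV f0 hf)).
by rewrite /GRing.scale /=; ring.
Qed.

Lemma is_derive_ln_comp (f : R -> R) x (df : R) :
  0 < f x -> is_derive x 1 f df -> is_derive x 1 (fun y => ln (f y)) (df / f x).
Proof.
move=> f0 hf; have -> : (fun y => ln (f y)) = (@ln R) \o f by [].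
have hl := is_derive1_ln f0.
apply: (is_derive_eq (is_derive1_comp hl hf)).
by rewrite /GRing.scale /=; ring.
Qed.

Section ratio.
Context (a : R) (a0 : 0 < a) (a1 : a <= 1).

Let k s := dcosh s * dsinh (a * s) - a * (dsinh s * dcosh (a * s)).

Let k_ge0 s : 0 <= s -> 0 <= k s.
Proof.
rewrite le_eqVlt => /predU1P[<-|s0]; first by rewrite /k mulr0 dsinh0; nra.
have dk x : is_derive x 1 k ((1 - a ^+ 2) * (dsinh x * dsinh (a * x))).
  have h := is_derive_sub
    (is_derive_mul (is_derive_dcosh x) (is_derive_dsinhM a x))
    (is_derive_mul (is_derive_cst a x 1) 
      (is_derive_mul (is_derive_dsinh x) (is_derive_dcoshM a x))).
  by apply: (is_derive_eq h); rewrite /cst /=; ring.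
have [c /andP[c0 cs]] := MVT_closed s0 (fun x _ => dk x).
rewrite {2}/k mulr0 dsinh0 mulr0 mul0r mulr0 !subr0 => ->.
rewrite mulr_ge0 ?(ltW s0)// mulr_ge0//; first by rewrite subr_ge0 exprn_ile1// ltW.
by rewrite mulr_ge0// ltW// dsinh_gt0// mulr_gt0.
Qed.

(** The derivative of the ratio has the sign of [k], which vanishes at 0 and has derivative (1 -
    a^2) [dsinh x] [dsinh (a * x)] >= 0. *)
Lemma dsinh_ratio x y : 0 < x -> x <= y ->
  dsinh x / dsinh (a * x) <= dsinh y / dsinh (a * y).
Proof.
move=> x0; rewrite le_eqVlt => /predU1P[<-//|xy].
have dr z : x <= z <= y ->
    is_derive z 1 (fun z => dsinh z / dsinh (a * z)) (k z / dsinh (a * z) ^+ 2).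
  move=> /andP[xz _]; have z0 : 0 < z by apply: lt_le_trans xz.
  have S0 : dsinh (a * z) != 0 by rewrite gt_eqF// dsinh_gt0// mulr_gt0.
  have h := is_derive_mul (is_derive_dsinh z)
    (is_derive_inv (f := fun z => dsinh (a * z)) S0 (is_derive_dsinhM a z)).
  by apply: (is_derive_eq h); rewrite /k; field.
have [c /andP[xc cy]] := MVT_closed xy dr.
have := k_ge0 (ltW (lt_trans x0 xc)) => kc.
move=> E; rewrite -subr_ge0 E mulr_ge0 ?subr_ge0 ?(ltW xy)//.
by rewrite divr_ge0// sqr_ge0.
Qed.
End ratio.
End legendre.

(** * Sign analysis behind the two-point inequality *)

Section single_crossing.
Context {R : realType}.
Section crossing.
Context (m : nat) (m2 : (2 <= m)%N).

Let q : R := qexp m.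
Let k : R := kappa m.
Let a : R := 2 * q - 1.
Let M : R := m%:R.
Let M0 : 0 < M. Proof. by rewrite ltr0n; lia. Qed.
Let k0 : 0 < k. Proof. exact: lt_trans ltr01 (kappa_gt1 m2). Qed.
Let q0 : 0 < q. Proof. exact: divr_gt0. Qed.
Let kq : k * q = M. Proof. by rewrite /q /qexp mulrC divfK// gt_eqF. Qed.
Let a0 : 0 < a.
Proof. by rewrite /a /q /qexp subr_gt0 mulrA ltr_pdivlMr// mul1r kappa_lt. Qed.
Let a1 : a <= 1.
Proof.
suff: q <= 1 by rewrite /a; lra.
by rewrite ler_pdivrMr// mul1r kappa_ge.
Qed.

(* [Dif] is the logarithm of the claimed inequality; it vanishes at 0 and has
   limit >= 0 at infinity. Its derivative has the sign of [n], and [V] is [n]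
   times an integrating factor of the equation that [n] inherits from Legendre's
   equation, so that [V'] has the sign of [h], which changes sign at most once,
   from - to +. If [Dif] were negative somewhere, then [n], hence [V], would go
   from negative to positive, so [V'] would be positive from then on, and [Dif]
   would grow without bound. *)
Let c s := dcosh (q * s).
Let t s := dsinh (q * s).
Let n s := M * (t s * legendre_sum m 0 s) - c s * legendre_sum m 1 s.
Let Dif s := k * ln (c s) - ln (legendre_sum m 0 s).

Let V s := expR ((k - 1) * ln (c s)) * n s * (dsinh s ^+ (2 * m))^-1.
Let h s := q * dsinh s - M * dsinh (a * s).

Let c0 s : 0 < c s. Proof. exact: dcosh_gt0. Qed.

Let dDif (s : R) : is_derive s 1 Dif (n s / (c s * legendre_sum m 0 s)).
Proof.
have p0 := legendre_sum_gt0 m s.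
have hh := is_derive_sub
  (is_derive_mul (is_derive_cst k s 1)
     (is_derive_ln_comp (f := c) (c0 s) (is_derive_dcoshM q s)))
  (is_derive_ln_comp p0 (is_derive_legendre_sum m 0 s)).
apply: (is_derive_eq hh); rewrite /cst /= /n -kq.
have cN : c s != 0 by rewrite gt_eqF.
have pN : legendre_sum m 0 s != 0 by rewrite gt_eqF.
rewrite /c /t in cN *.
by field; rewrite cN pN.
Qed.

Let dn (s : R) : is_derive s 1 n
  (M * q * c s * legendre_sum m 0 s + M * t s * legendre_sum m 1 s - q * t s * legendre_sum m 1 s
   - c s * legendre_sum m 2 s).
Proof.
have hh := is_derive_sub
  (is_derive_mul (is_derive_cst M s 1)
     (is_derive_mul (is_derive_dsinhM q s) (is_derive_legendre_sum m 0 s)))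
  (is_derive_mul (is_derive_dcoshM q s) (is_derive_legendre_sum m 1 s)).
by apply: (is_derive_eq hh); rewrite /cst /= /t /c; ring.
Qed.

Let dpow (s : R) : 0 < s -> is_derive s 1 (fun x => (dsinh x ^+ (2 * m))^-1)
  (- ((2 * M) * dcosh s / dsinh s) * (dsinh s ^+ (2 * m))^-1).
Proof.
move=> s0; have S0 : dsinh s != 0 by rewrite gt_eqF// dsinh_gt0.
have d1 := is_deriveX (2 * m) (is_derive_dsinh s).
have Sm0 : (dsinh ^+ (2 * m)) s != 0 by rewrite fctE expf_neq0.
have d2 := is_derive_inv (f := dsinh ^+ (2 * m)) Sm0 d1.
rewrite (_ : (fun x => _) = (fun x => ((dsinh ^+ (2 * m)) x)^-1)); last first.
  by apply/funext => x; rewrite fctE.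
apply: (is_derive_eq d2).
have -> : 2 * M = (2 * m)%:R by rewrite natrM.
have [p ->] : exists p, (2 * m = p.+1)%N by exists (2 * m).-1; lia.
rewrite fctE /GRing.scale /= !exprS.
by field; rewrite S0 expf_neq0.
Qed.

(** The left side is V' divided by the two weights that multiply [n] in [V]. Legendre's equation
    removes the second derivative; the first derivatives then cancel, and hyperbolic identities
    leave a positive multiple of [h]. *)
Let crossE s : 0 < s ->
  (k - 1) * (q * t s / c s) * n s
  + (M * q * c s * legendre_sum m 0 s + M * t s * legendre_sum m 1 s - q * t s * legendre_sum m 1 s
   - c s * legendre_sum m 2 s) - 2 * M * dcosh s / dsinh s * n s =
  4 * M * legendre_sum m 0 s / (c s * dsinh s) * h s.
Proof.
move=> s0; have S0 : dsinh s != 0 by rewrite gt_eqF// dsinh_gt0.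
have C0 : c s != 0 by rewrite gt_eqF.
have ode : legendre_sum m 2 s = (2 * M * dcosh s * legendre_sum m 1 s
    - M ^+ 2 * dsinh s * legendre_sum m 0 s) / dsinh s.
  by apply: (canRL (mulfK S0)); rewrite mulrC; exact: legendre_sum_ode.
have h1 : c s ^+ 2 - t s ^+ 2 = 4.
  have : expR (q * s) * expR (- (q * s)) = 1 by rewrite expRN mulfV// gt_eqF// expR_gt0.
  rewrite /c /t /dcosh /dsinh => E.
  by transitivity (4 * (expR (q * s) * expR (- (q * s)))); [ring|rewrite E mulr1].
(* This is the subtraction formula for sinh (s - 2qs), with a = 2q - 1. *)
have h2 : dsinh s * (t s ^+ 2 + c s ^+ 2) - 2 * dcosh s * c s * t s = - 4 * dsinh (a * s).
  have -> : a * s = q * s + q * s - s by rewrite /a; ring.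
  rewrite /c /t /dcosh /dsinh !opprD opprK !expRD.
  set x := expR (q * s); set y := expR s; set x' := expR (- (q * s)); set y' := expR (- s).
  by ring.
have -> : (k - 1) * (q * t s / c s) = (M - q) * (t s / c s) by rewrite -kq; ring.
rewrite ode /n.
transitivity (M * legendre_sum m 0 s * (q * dsinh s * (c s ^+ 2 - t s ^+ 2) +
  M * (dsinh s * (t s ^+ 2 + c s ^+ 2) - 2 * dcosh s * c s * t s)) / (c s * dsinh s)).
  by field; rewrite S0.
by rewrite h1 h2 /h; field; rewrite S0.
Qed.

Let dV (s : R) : 0 < s -> is_derive s 1 V
  (expR ((k - 1) * ln (c s)) * (dsinh s ^+ (2 * m))^-1 *
   (4 * M * legendre_sum m 0 s / (c s * dsinh s)) * h s).
Proof.
move=> s0.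
have d1 := is_derive_mul (is_derive_cst (k - 1) s 1)
     (is_derive_ln_comp (f := c) (c0 s) (is_derive_dcoshM q s)).
have d2 := is_derive1_comp (is_derive_expR _) d1.
have d3 := is_derive_mul (is_derive_mul d2 (dn s)) (dpow s0).
apply: (is_derive_eq d3).
rewrite -[RHS]mulrA -(crossE s0) /cst /= /GRing.scale /= /t.
ring.
Qed.
Let B : R := ('C(2 * m, m))%:R.
Let B0 : 0 < B. Proof. by rewrite ltr0n bin_gt0; lia. Qed.

Let lnc_ge s : q * s <= ln (c s).
Proof.
rewrite -[leLHS]expRK ler_ln ?posrE ?expR_gt0//.
by rewrite /c /dcosh lerDl expR_ge0.
Qed.

Let lnc_le s : 0 <= s -> ln (c s) <= ln 2 + q * s.
Proof.
move=> s0; rewrite -[X in _ <= _ + X]expRK -lnM ?posrE ?expR_gt0//.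
rewrite ler_ln ?posrE ?mulr_gt0 ?expR_gt0//.
rewrite /c /dcosh mulr_natl mulr2n lerD2l ler_expR.
have := mulr_ge0 (ltW q0) s0; lra.
Qed.

Let Dif0 : Dif 0 = 0.
Proof.
rewrite /Dif legendre_sum00 /c mulr0 /dcosh oppr0 expR0 -[1 + 1]/(2%:R) /k kappaE//.
by rewrite subrr.
Qed.

Let Dif_le s : 0 <= s -> Dif s <= k * ln 2.
Proof.
move=> s0; rewrite /Dif lerBlDr.
have h1 : k * ln (c s) <= k * ln 2 + M * s.
  by rewrite -kq -mulrA -mulrDr ler_wpM2l ?(ltW k0) ?lnc_le.
apply: (le_trans h1); rewrite lerD2l -[leLHS]expRK.
by rewrite ler_ln ?posrE ?expR_gt0 ?legendre_sum_gt0 ?legendre_sum_ge.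
Qed.

(** This is the nonnegative limit at infinity in quantitative form: k ln [c s] >= M s, while
    [legendre_sum m 0 s] exceeds e^(M s) by a relative error of at most B e^(-2s). *)
Let Dif_ge s : 0 <= s -> - (B * expR (- (2 * s))) <= Dif s.
Proof.
move=> s0; rewrite /Dif.
have h1 : M * s <= k * ln (c s) by rewrite -kq -mulrA ler_wpM2l ?(ltW k0) ?lnc_ge.
have B1 : 0 <= B * expR (- (2 * s)) by rewrite mulr_ge0 ?expR_ge0 ?(ltW B0).
have h2 : ln (legendre_sum m 0 s) <= M * s + B * expR (- (2 * s)).
  rewrite -[leRHS]expRK ler_ln ?posrE ?expR_gt0 ?legendre_sum_gt0// expRD.
  apply: (le_trans (legendre_sum_le m s0)); rewrite ler_wpM2l ?expR_ge0//.
  exact: expR_ge1Dx.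
lra.
Qed.

Let V_sgn s : 0 < s -> (0 < V s) = (0 < n s) /\ (V s < 0) = (n s < 0).
Proof.
move=> s0; have w0 : 0 < (dsinh s ^+ (2 * m))^-1 by rewrite invr_gt0 exprn_gt0 ?dsinh_gt0.
by rewrite /V pmulr_lgt0// pmulr_rgt0 ?expR_gt0// pmulr_llt0// pmulr_rlt0 ?expR_gt0.
Qed.

Let h_pos x y : 0 < x -> x <= y -> 0 < h x -> 0 < h y.
Proof.
move=> x0 xy; have y0 : 0 < y by apply: lt_le_trans xy.
have := dsinh_ratio a0 a1 x0 xy.
have Sx : 0 < dsinh (a * x) by rewrite dsinh_gt0// mulr_gt0.
have Sy : 0 < dsinh (a * y) by rewrite dsinh_gt0// mulr_gt0.
move=> hr; rewrite /h !subr_gt0 -!ltr_pdivlMr//.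
move=> /lt_le_trans; apply.
by rewrite -[leLHS]mulrA -[leRHS]mulrA ler_wpM2l// ltW.
Qed.

Let Dif_mvt x y : 0 <= x -> x < y -> exists2 z, x < z < y &
  Dif y - Dif x = n z / (c z * legendre_sum m 0 z) * (y - x).
Proof. by move=> x0 xy; apply: MVT_closed => // s _; exact: dDif. Qed.

(** Undoing the integrating factor writes the derivative of [Dif] as [V s] times a quotient whose
    numerator is at least a constant times e^(2Ms) and whose denominator is at most a constant times
    e^(2Ms). *)
Let Dif_slope s2 : 0 < s2 -> 0 < V s2 ->
  (forall s, s2 <= s -> V s2 <= V s) ->
  exists2 e, 0 < e & forall s, s2 <= s -> e <= n s / (c s * legendre_sum m 0 s).
Proof.
move=> s20 v0 vmon.
(* For s >= s2 this constant satisfies g e^s <= [dsinh s]. *)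
pose g := 1 - expR (- (2 * s2)).
have g0 : 0 < g by rewrite subr_gt0 -[ltRHS]expR0 ltr_expR; lra.
exists (V s2 * g ^+ (2 * m) / (expR (k * ln 2) * (1 + B))).
  apply: divr_gt0; apply: mulr_gt0 => //.
  - exact: exprn_gt0.
  - exact: expR_gt0.
  - exact: addr_gt0.
move=> s s2s; have s0 : 0 < s by apply: lt_le_trans s2s.
have nE : n s / (c s * legendre_sum m 0 s) =
    V s * dsinh s ^+ (2 * m) / (expR (k * ln (c s)) * legendre_sum m 0 s).
  have -> : expR (k * ln (c s)) = expR ((k - 1) * ln (c s)) * c s.
    by rewrite -[X in _ = _ * X]lnK ?posrE// -expRD; congr expR; ring.
  rewrite /V; field.
  by rewrite ?(gt_eqF (c0 s)) ?(gt_eqF (legendre_sum_gt0 _ _)) ?(gt_eqF (expR_gt0 _))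
    ?expf_neq0// ?gt_eqF ?dsinh_gt0.
rewrite nE; have es0 := expR_gt0 s.
have hS : g * expR s <= dsinh s.
  rewrite /g /dsinh mulrBl mul1r lerB// -expRD ler_expR; lra.
have hSm : g ^+ (2 * m) * expR (M * s) ^+ 2 <= dsinh s ^+ (2 * m).
  have -> : expR (M * s) ^+ 2 = expR s ^+ (2 * m).
    by rewrite -!expRM_natl; congr expR; rewrite natrM /M; ring.
  rewrite -exprMn lerXn2r ?nnegrE//.
    by rewrite mulr_ge0// ltW.
  by rewrite ltW// dsinh_gt0.
have hD : expR (k * ln (c s)) * legendre_sum m 0 s <=
    expR (k * ln 2) * (1 + B) * expR (M * s) ^+ 2.
  have -> : expR (k * ln 2) * (1 + B) * expR (M * s) ^+ 2 =
    (expR (k * ln 2) * expR (M * s)) * (expR (M * s) * (1 + B)) by ring.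
  rewrite ler_pM ?expR_ge0 ?(ltW (legendre_sum_gt0 _ _))//.
    rewrite -expRD ler_expR -kq -mulrA -mulrDr ler_wpM2l ?(ltW k0)//.
    exact/lnc_le/ltW.
  apply: (le_trans (legendre_sum_le m (ltW s0))).
  rewrite ler_wpM2l ?expR_ge0// lerD2l -[leRHS]mulr1 ler_wpM2l ?(ltW B0)//.
  rewrite -[leRHS]expR0 ler_expR; lra.
rewrite ler_pdivrMr ?mulr_gt0 ?expR_gt0 ?addr_gt0//.
rewrite [leRHS]mulrAC ler_pdivlMr ?mulr_gt0 ?expR_gt0 ?legendre_sum_gt0//.
apply: (@le_trans _ _ (V s2 * g ^+ (2 * m) *
  (expR (k * ln 2) * (1 + B) * expR (M * s) ^+ 2))).
  by rewrite ler_wpM2l// mulr_ge0 ?exprn_ge0 ?(ltW g0) ?(ltW v0).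
have -> : V s2 * g ^+ (2 * m) * (expR (k * ln 2) * (1 + B) * expR (M * s) ^+ 2) =
  V s2 * (g ^+ (2 * m) * expR (M * s) ^+ 2) * (expR (k * ln 2) * (1 + B)) by ring.
rewrite ler_wpM2r ?mulr_ge0 ?expR_ge0 ?addr_ge0 ?(ltW B0)//.
rewrite ler_pM ?vmon ?(ltW v0)// mulr_ge0 ?exprn_ge0 ?expR_ge0 ?(ltW g0)//.
Qed.

Let Dif_ge0 s0 : 0 < s0 -> 0 <= Dif s0.
Proof.
move=> s00; rewrite leNgt; apply/negP => D0.
(* The point lies beyond [s0] and far enough out that [Dif_ge] forces [Dif s0 < Dif x]. *)
pose x := Num.max (s0 + 1) (ln (B / - Dif s0)).
have xs0 : s0 < x by rewrite lt_max ltrDl ltr01.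
have x0 : 0 < x by apply: lt_trans xs0.
have Dx : Dif s0 < Dif x.
  apply: lt_le_trans (Dif_ge (ltW x0)); rewrite ltrNr.
  have e1 : expR (- x) <= - Dif s0 / B.
    have -> : - Dif s0 / B = expR (- ln (B / - Dif s0)).
      by rewrite expRN lnK ?invf_div// posrE divr_gt0// oppr_gt0.
    by rewrite ler_expR lerN2 le_max lexx orbT.
  rewrite mulrC -ltr_pdivlMr//; apply: lt_le_trans e1.
  rewrite ltr_expR; lra.
have [s1 /andP[s10 s1s]] := Dif_mvt (lexx 0) s00.
rewrite Dif0 !subr0 => E1.
have n1 : n s1 < 0.
  have : n s1 / (c s1 * legendre_sum m 0 s1) < 0 by rewrite -(pmulr_llt0 _ s00) -E1.
  by rewrite pmulr_llt0// invr_gt0 mulr_gt0// legendre_sum_gt0.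
have [s2 /andP[ss2 s2x]] := Dif_mvt (ltW s00) xs0.
have xms : 0 < x - s0 by rewrite subr_gt0.
move=> E2.
have n2 : 0 < n s2.
  have : 0 < n s2 / (c s2 * legendre_sum m 0 s2) by rewrite -(pmulr_lgt0 _ xms) -E2 subr_gt0.
  by rewrite pmulr_lgt0// invr_gt0 mulr_gt0// legendre_sum_gt0.
have s12 : s1 < s2 by apply: lt_trans ss2.
have s20 : 0 < s2 by apply: lt_trans s12.
have V1 : V s1 < 0 by have [_ ->] := V_sgn s10.
have V2 : 0 < V s2 by have [-> _] := V_sgn s20.
have Vw s : 0 < s -> 0 < expR ((k - 1) * ln (c s)) / dsinh s ^+ (2 * m) *
   (4 * M * legendre_sum m 0 s / (c s * dsinh s)).
  move=> hs; rewrite mulr_gt0 ?divr_gt0 ?mulr_gt0 ?expR_gt0 ?exprn_gt0 ?legendre_sum_gt0//;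
  exact: dsinh_gt0.
have [z /andP[s1z zs2] Ez] := MVT_closed (f := V) s12
  (fun s hs => dV (lt_le_trans s10 (proj1 (andP hs)))).
have z0 : 0 < z by apply: lt_trans s1z.
have hz : 0 < h z.
  have : 0 < V s2 - V s1 by rewrite subr_gt0 (lt_trans V1).
  have ds : 0 < s2 - s1 by rewrite subr_gt0.
  by rewrite Ez (pmulr_lgt0 _ ds) (pmulr_rgt0 _ (Vw _ z0)).
have vmon s : s2 <= s -> V s2 <= V s.
  rewrite le_eqVlt => /predU1P[<-//|s2s].
  have [y /andP[s2y _] Ey] := MVT_closed (f := V) s2s
    (fun s hs => dV (lt_le_trans s20 (proj1 (andP hs)))).
  have y0 : 0 < y by apply: lt_trans s2y.
  rewrite -subr_ge0 Ey mulr_ge0 ?subr_ge0 ?(ltW s2s)//.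
  apply: mulr_ge0; first exact: ltW (Vw _ y0).
  apply/ltW/(h_pos z0) => //; apply/ltW.
  exact: lt_trans s2y.
have [e e0 he] := Dif_slope s20 V2 vmon.
(* Over a length [T] the slope [e] yields an increase of k ln 2 + B + 1, more than the room between
   the bounds -B and k ln 2 on [Dif]. *)
pose T := (k * ln 2 + B + 1) / e.
have kl : 0 <= k * ln 2 by rewrite mulr_ge0 ?(ltW k0)// ln_ge0// ler1n.
have T0 : 0 < T by rewrite divr_gt0//; move: B0; lra.
have sT : s2 < s2 + T by rewrite ltrDl.
have [y /andP[s2y _] Ey] := Dif_mvt (ltW s20) sT.
have := he _ (ltW s2y).
have -> : n y / (c y * legendre_sum m 0 y) = (Dif (s2 + T) - Dif s2) / T.
  by rewrite Ey [s2 + T]addrC addrK mulfK// gt_eqF.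
rewrite ler_pdivlMr// /T mulrC divfK ?gt_eqF//.
have := Dif_le (ltW (lt_trans s20 sT)).
have := Dif_ge (ltW s20).
have : B * expR (- (2 * s2)) <= B.
  rewrite -[leRHS]mulr1 ler_wpM2l ?(ltW B0)// -[leRHS]expR0 ler_expR; lra.
lra.
Qed.

Lemma legendre_sum_le_dcosh (s : R) : 0 <= s ->
  legendre_sum m 0 s <= dcosh (qexp m * s) `^ kappa m.
Proof.
move=> s0; rewrite /powR gt_eqF ?dcosh_gt0// -ler_ln ?posrE ?legendre_sum_gt0 ?expR_gt0//.
rewrite expRK -subr_ge0; move: s0; rewrite le_eqVlt => /predU1P[<-|s0].
  by have := Dif0; rewrite /Dif /c /k /q => ->.
exact: Dif_ge0.
Qed.
End crossing.
End single_crossing.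

(** * The two-point inequality with weights *)

Section two_point_weighted.
Context {R : realType} (m : nat) (m2 : (2 <= m)%N).
Implicit Types (x y A B n : R).

Definition bin_form (m : nat) A B : R :=
  \sum_(j < m.+1) ('C(m, j) ^ 2)%:R * (A ^+ j * B ^+ (m - j)).

Lemma bin_formC A B : bin_form m A B = bin_form m B A.
Proof.
rewrite /bin_form (reindex_inj rev_ord_inj) /=; apply: eq_bigr => j _.
have jm : (j <= m)%N by rewrite -ltnS.
by rewrite subSS bin_sub// subKn// [A ^+ _ * _]mulrC.
Qed.

Lemma bin_form0l B : bin_form m 0 B = B ^+ m.
Proof.
rewrite /bin_form big_ord_recl /= bin0 exp1n expr0 !mul1r subn0 big1 ?addr0// => j _.
by rewrite expr0n /= mul0r mulr0.
Qed.

(** Homogeneity: once a power of the geometric mean is taken out, only the ratio of the two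
    arguments matters. *)
Lemma bin_form_expR x y : bin_form m (expR x) (expR y) =
  expR (m%:R * (x + y) / 2) * legendre_sum m 0 ((x - y) / 2).
Proof.
rewrite /legendre_sum mulr_sumr; apply: eq_bigr => j _.
have jm : (j <= m)%N by rewrite -ltnS.
rewrite expr0 mulr1 [RHS]mulrCA; congr (_ * _).
rewrite -!expRM_natl -!expRD; congr expR.
by rewrite natrB// natrM; field.
Qed.

Let k : R := kappa m.
Let q : R := qexp m.
Let k1 : 1 < k. Proof. exact: kappa_gt1. Qed.
Let k0 : 0 < k. Proof. exact: lt_trans k1. Qed.
Let kq : k * q = m%:R. Proof. by rewrite /q /qexp mulrC divfK// gt_eqF. Qed.

Let bin_form_expR_le x y : y <= x ->
  bin_form m (expR x) (expR y) <= (expR (q * x) + expR (q * y)) `^ k.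
Proof.
move=> yx; rewrite bin_form_expR.
have s0 : 0 <= (x - y) / 2 by rewrite divr_ge0// subr_ge0.
have := legendre_sum_le_dcosh m2 s0; rewrite -/k -/q => hs.
have -> : expR (m%:R * (x + y) / 2) = expR (q * ((x + y) / 2)) `^ k.
  by rewrite /powR gt_eqF ?expR_gt0// expRK -kq; congr expR; ring.
have -> : expR (q * x) + expR (q * y) =
    expR (q * ((x + y) / 2)) * dcosh (q * ((x - y) / 2)).
  by rewrite /dcosh mulrDr -!expRD; congr (expR _ + expR _); field.
rewrite powRM ?expR_ge0 ?(ltW (dcosh_gt0 _))//.
by rewrite ler_wpM2l// powR_ge0.
Qed.

(** Convexity of x^k with weights n0/(n0+n1) and n1/(n0+n1), applied at the points A (n0+n1)/n0 and
    B (n0+n1)/n1, whose weighted mean is A + B. *)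
Let powR_perspective A B n0 n1 : 0 <= A -> 0 <= B -> 0 < n0 -> 0 < n1 ->
  (A + B) `^ k <=
  (n0 + n1) `^ (k - 1) * (n0 `^ (1 - k) * A `^ k + n1 `^ (1 - k) * B `^ k).
Proof.
move=> A0 B0 n00 n10.
have N0 : 0 < n0 + n1 by rewrite addr_gt0.
have l0 : 0 <= n0 / (n0 + n1) by rewrite divr_ge0 ?ltW.
have l1 : n0 / (n0 + n1) <= 1 by rewrite ler_pdivrMr// mul1r lerDl ltW.
have cvx (x y : R) : 0 <= x -> 0 <= y ->
    (n0 / (n0 + n1) * x + (1 - n0 / (n0 + n1)) * y) `^ k <=
    n0 / (n0 + n1) * x `^ k + (1 - n0 / (n0 + n1)) * y `^ k.
  move=> x0 y0; have := @convex_powR R k (ltW k1) (Itv01 l0 l1) x y.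
  by rewrite !convRE /=; apply; rewrite inE /= in_itv /= andbT.
have := cvx (A * (n0 + n1) / n0) (B * (n0 + n1) / n1).
have -> : 1 - n0 / (n0 + n1) = n1 / (n0 + n1) by field; rewrite gt_eqF.
have -> : n0 / (n0 + n1) * (A * (n0 + n1) / n0) + n1 / (n0 + n1) * (B * (n0 + n1) / n1)
  = A + B by field; rewrite !gt_eqF.
have g (z w N : R) : 0 <= z -> 0 < w -> 0 < N ->
   w / N * (z * N / w) `^ k = N `^ (k - 1) * (w `^ (1 - k) * z `^ k).
  move=> z0 w0 NN0; rewrite !powRM ?mulr_ge0 ?invr_ge0 ?(ltW w0) ?(ltW NN0)//.
  have -> : w^-1 `^ k = w `^ (- k) by rewrite -powR_inv1 ?(ltW w0)// -powRrM mulN1r.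
  have -> : w `^ (1 - k) = w * w `^ (- k)
    by rewrite powRD ?powRr1 ?(ltW w0)// (gt_eqF w0) implybT.
  have -> : N `^ (k - 1) = N `^ k * N^-1
    by rewrite powRD ?powR_inv1 ?(ltW NN0)// (gt_eqF NN0) implybT.
  ring.
rewrite !g// -mulrDr; apply;
by rewrite divr_ge0 ?mulr_ge0 ?(ltW n00) ?(ltW n10) ?(ltW N0).
Qed.

Let weighted_le A B n0 n1 : 0 < B -> B <= A -> 0 < n0 -> 0 < n1 ->
  (n0 + n1) `^ (1 - k) * bin_form m A B <=
  n0 `^ (1 - k) * A ^+ m + n1 `^ (1 - k) * B ^+ m.
Proof.
move=> B0 BA n00 n10; have A0 : 0 < A by apply: lt_le_trans BA.
have N0 : 0 < n0 + n1 by rewrite addr_gt0.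
have lBA : ln B <= ln A by rewrite ler_ln.
have := bin_form_expR_le lBA; rewrite !lnK ?posrE// => h.
have pe z : 0 < z -> expR (q * ln z) `^ k = z ^+ m.
  move=> z0; rewrite /powR gt_eqF ?expR_gt0// expRK mulrA kq.
  by rewrite expRM_natl lnK.
have := powR_perspective (expR_ge0 (q * ln A)) (expR_ge0 (q * ln B)) n00 n10.
rewrite !pe// => h2; have := le_trans h h2.
have -> : (n0 + n1) `^ (k - 1) = ((n0 + n1) `^ (1 - k))^-1 by rewrite -powRN opprB.
by rewrite mulrC ler_pdivlMr ?powR_gt0// mulrC.
Qed.

(** The case A = 0. As 1 - k is negative, enlarging the base lowers the power; if n1 = 0, both sides
    vanish. *)
Let weighted_edge B n0 n1 : 0 <= B -> 0 <= n0 -> 0 <= n1 -> (n1 = 0 -> B = 0) ->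
  (n0 + n1) `^ (1 - k) * B ^+ m <= n1 `^ (1 - k) * B ^+ m.
Proof.
move=> B0 n00; rewrite le_eqVlt => /predU1P[<- /(_ erefl) ->|n10 _].
  by rewrite expr0n gtn_eqF ?mulr0//; lia.
rewrite ler_wpM2r ?exprn_ge0//.
rewrite -[1 - k]opprB !powRN lef_pV2 ?posrE ?powR_gt0 ?ltr_wpDl//.
have km1 : 0 <= k - 1 by rewrite subr_ge0 ltW.
apply: (ge0_ler_powR km1); rewrite ?nnegrE ?lerDr ?(ltW n10)//.
by rewrite addr_ge0 // ltW.
Qed.

(** In the tree, [n0] and [n1] count the points below two nodes, and the implications say that a
    node without points has logarithm 0. *)
Lemma two_point_weighted A B n0 n1 : 0 <= A -> 0 <= B -> 0 <= n0 -> 0 <= n1 ->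
  (n0 = 0 -> A = 0) -> (n1 = 0 -> B = 0) ->
  (n0 + n1) `^ (1 - kappa m) * bin_form m A B <=
  n0 `^ (1 - kappa m) * A ^+ m + n1 `^ (1 - kappa m) * B ^+ m.
Proof.
move=> A0 B0 n00 n10 nA nB; rewrite -/k.
have m0 : (m == 0) = false by apply: gtn_eqF; lia.
have [A00|Ap] : A = 0 \/ 0 < A by move: A0; rewrite le_eqVlt => /predU1P[<-|]; auto.
  by rewrite A00 bin_form0l expr0n m0 mulr0 add0r weighted_edge.
have [B00|Bp] : B = 0 \/ 0 < B by move: B0; rewrite le_eqVlt => /predU1P[<-|]; auto.
  by rewrite bin_formC B00 bin_form0l expr0n m0 mulr0 addr0 addrC weighted_edge.
have n0p : 0 < n0 by rewrite lt_neqAle n00 andbT; apply/eqP => /esym/nA AA; rewrite AA ltxx in Ap.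
have n1p : 0 < n1 by rewrite lt_neqAle n10 andbT; apply/eqP => /esym/nB AA; rewrite AA ltxx in Bp.
have [BA|/ltW AB] := leP B A; first exact: weighted_le.
by rewrite bin_formC [n0 + n1]addrC [leRHS]addrC weighted_le.
Qed.
End two_point_weighted.

(** * Means over the circle *)

Section mean.
Context {R : realType}.
Local Notation mu := (@lebesgue_measure R).
Implicit Types f g : R -> R.

Lemma continuous_itv_integrable f (a b : R) : continuous f ->
  mu.-integrable `[a, b] (EFin \o f).
Proof.
move=> cf; apply: continuous_compact_integrable; first exact: segment_compact.
exact: continuous_subspaceT.
Qed.

Lemma Rintegral_chasles f (a c b : R) : continuous f -> a <= c -> c <= b ->
  \int[mu]_(x in `[a, b]) f x = \int[mu]_(x in `[a, c]) f x + \int[mu]_(x in `[c, b]) f x.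
Proof.
move=> cf ac cb; apply/eqP; rewrite addrC -subr_eq; apply/eqP.
rewrite Rintegral_itvB ?bnd_simp//; last exact: continuous_itv_integrable.
apply: Rintegral_itv_obnd_cbnd.
apply: (@integrableS _ _ _ mu `[c, b]) => //.
  by apply: subset_itvr; rewrite bnd_simp.
exact: continuous_itv_integrable.
Qed.

Lemma Rintegral_shift f (a b h : R) : continuous f -> a <= b ->
  \int[mu]_(x in `[a, b]) f (x + h) = \int[mu]_(x in `[a + h, b + h]) f x.
Proof.
move=> cf ab; rewrite /Rintegral; congr fine.
have d1 (x : R) : is_derive x 1 (fun y : R => y + h) 1.
  have := is_deriveD (is_derive_id x 1) (is_derive_cst h x 1).
  by rewrite addr0.
have dE : derive1 (fun y : R => y + h) = cst 1.
  by apply/funext => x; rewrite derive1E; have [_ ->] := d1 x.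
have ch : continuous (fun y : R => y + h).
  by move=> x; apply: cvgD; [exact: cvg_id|exact: cvg_cst].
rewrite (@integration_by_substitution_increasing R (fun x => x + h) f a b ab).
- by apply: eq_integral => x _ /=; rewrite dE /= mulr1.
- by move=> x y _ _ xy; rewrite ltrD2r.
- by rewrite dE => x _; exact: cvg_cst.
- by rewrite dE; exact: is_cvg_cst.
- by rewrite dE; exact: is_cvg_cst.
- split.
  + by move=> x _; have [] := d1 x.
  + by apply: cvg_at_right_filter; exact: ch.
  + by apply: cvg_at_left_filter; exact: ch.
- exact: continuous_subspaceT.
Qed.

Definition mean f : R := \int[mu]_(x in `[0, 1]) f x.

(** The shifted interval [h, 1+h] is cut at 1, and periodicity moves the piece [1, 1+h] back to
    [0, h]. *)
Lemma mean_shift f (h : R) : continuous f -> (forall x, f (x + 1) = f x) ->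
  0 <= h <= 1 -> mean (fun x => f (x + h)) = mean f.
Proof.
move=> cf pf /andP[h0 h1]; rewrite /mean Rintegral_shift// add0r.
rewrite (@Rintegral_chasles f h 1 (1 + h))//; last by rewrite lerDl.
have -> : \int[mu]_(x in `[1, 1 + h]) f x = \int[mu]_(x in `[0, h]) f x.
  have -> : `[1, 1 + h] = `[0 + 1, h + 1] by rewrite add0r addrC.
  by rewrite -Rintegral_shift//; apply: eq_Rintegral => x _; rewrite pf.
by rewrite addrC -(@Rintegral_chasles f 0 h 1).
Qed.

Lemma mean_cst (c : R) : mean (fun=> c) = c.
Proof.
have h : mu `[(0 : R), 1] = 1%E by rewrite lebesgue_measure_itv /= lte_fin ltr01 sube0.
by rewrite /mean Rintegral_cst// [X in fine X]h mulr1.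
Qed.

Lemma meanD f g : continuous f -> continuous g ->
  mean (fun x => f x + g x) = mean f + mean g.
Proof. by move=> cf cg; rewrite /mean RintegralD//; exact: continuous_itv_integrable. Qed.

Lemma meanZ (c : R) f : continuous f -> mean (fun x => c * f x) = c * mean f.
Proof. by move=> cf; rewrite /mean RintegralZl//; exact: continuous_itv_integrable. Qed.

Lemma le_mean f g : continuous f -> continuous g ->
  (forall x, f x <= g x) -> mean f <= mean g.
Proof.
by move=> cf cg fg; apply: le_Rintegral => //; exact: continuous_itv_integrable.
Qed.

Lemma continuousD_fct f g : continuous f -> continuous g ->
  continuous (fun x => f x + g x).
Proof. by move=> cf cg x; apply: cvgD; [exact: cf|exact: cg]. Qed.

Lemma continuousX_fct f n : continuous f -> continuous (fun x => f x ^+ n).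
Proof.
move=> cf s; apply: (@continuous_comp _ _ _ f (fun x => x ^+ n)); first exact: cf.
exact: exprn_continuous.
Qed.

Lemma continuousZ_fct (k : R) f : continuous f -> continuous (fun x => k * f x).
Proof. by move=> cf s; apply: cvgMr; exact: cf. Qed.

Lemma continuous_shift_fct f (h : R) : continuous f -> continuous (fun x => f (x + h)).
Proof.
move=> cf x; apply: (@continuous_comp _ _ _ (fun y : R => y + h) f); last exact: cf.
by apply: cvgD; [exact: cvg_id|exact: cvg_cst].
Qed.

Lemma continuous_sum_fct n (f : 'I_n -> R -> R) : (forall i, continuous (f i)) ->
  continuous (fun x => \sum_(i < n) f i x).
Proof.
elim: n f => [|n IH] f cf.
  rewrite (_ : (fun x => _) = cst 0); last by apply/funext => x; rewrite big_ord0.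
  by move=> x; exact: cvg_cst.
rewrite (_ : (fun x => _) = fun x =>
    \sum_(i < n) f (widen_ord (leqnSn n) i) x + f ord_max x).
  by apply: continuousD_fct; [apply: IH => i|]; exact: cf.
by apply/funext => x; rewrite big_ord_recr.
Qed.

Lemma mean_sum n (f : 'I_n -> R -> R) : (forall i, continuous (f i)) ->
  mean (fun x => \sum_(i < n) f i x) = \sum_(i < n) mean (f i).
Proof.
elim: n f => [|n IH] f cf.
  by rewrite big_ord0 -[RHS]mean_cst; apply: eq_Rintegral => x _; rewrite big_ord0.
rewrite big_ord_recr /= -IH; last by move=> i; exact: cf.
rewrite -meanD; [|by apply: continuous_sum_fct => i; exact: cf|exact: cf].
by apply: eq_Rintegral => x _; rewrite big_ord_recr.
Qed.

Lemma mean_uniform f : continuous f -> (forall x, 0 <= f x) ->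
  (\int[uniform_prob (@ltr01 R)]_x (f x)%:E)%E = (mean f)%:E.
Proof.
move=> cf f0; rewrite integral_uniform.
- rewrite subr0 invr1 mul1e /mean /Rintegral fineK//.
  exact: integrable_fin_num (continuous_itv_integrable 0 1 cf).
- apply/measurable_EFinP; exact: continuous_measurable_fun.
- by move=> x; rewrite lee_fin.
Qed.

End mean.

(** * Trigonometric means and the mean of ln |1 + rho e^(i theta)|^2 *)

Section circle.
Context {R : realType}.
Implicit Types s h rho : R.

Lemma cosD2piM (x : R) (n : nat) : cos (x + 2 * pi * n%:R) = cos x.
Proof.
elim: n => [|n IH]; first by rewrite mulr0 addr0.
rewrite -[n.+1]addn1 natrD mulrDr mulr1 addrA -[RHS]IH -[RHS]cosD2pi; congr cos.
by rewrite mulr_natl.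
Qed.

Lemma continuous_cosM (k : R) : continuous (fun s : R => cos (2 * pi * (k * s))).
Proof.
move=> s; apply: continuous_comp; last exact: continuous_cos.
by apply: cvgMr; apply: cvgMr; exact: cvg_id.
Qed.

(** For n > 0, a shift by the half period 1/(2n) preserves the mean and changes the sign of the
    function. *)
Lemma mean_cosM (n : nat) : mean (fun s : R => cos (2 * pi * (n%:R * s))) = (n == 0)%:R.
Proof.
case: n => [|n].
  rewrite -[RHS]mean_cst; apply: eq_Rintegral => s _.
  by rewrite mul0r mulr0 cos0.
have n0 : (n.+1%:R : R) != 0 by rewrite pnatr_eq0.
set f := fun s : R => _.
have cf : continuous f by exact: continuous_cosM.
have pf s : f (s + 1) = f s.
  by rewrite /f -[RHS](cosD2piM _ n.+1); congr cos; ring.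
have hh : 0 <= (2 * n.+1%:R : R)^-1 <= 1.
  rewrite invr_ge0 mulr_ge0//= invf_le1 ?mulr_gt0//.
  by rewrite -natrM ler1n.
have := mean_shift cf pf hh.
have -> : mean (fun s => f (s + (2 * n.+1%:R)^-1)) = mean (fun s => -1 * f s).
  apply: eq_Rintegral => s _; rewrite mulN1r /f -cosDpi; congr cos.
  by field; rewrite addrC natr1.
rewrite meanZ//= => E; lra.
Qed.

Lemma mean_cosB (j k : nat) :
  mean (fun s : R => cos (2 * pi * ((j%:R - k%:R) * s))) = (j == k)%:R.
Proof.
have [jk|/ltnW kj] := leqP j k.
  have -> : (j == k) = ((k - j)%N == 0) by rewrite subn_eq0 eqn_leq jk.
  rewrite -mean_cosM; apply: eq_Rintegral => s _.
  by rewrite -cosN natrB//; congr cos; ring.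
have -> : (j == k) = ((j - k)%N == 0) by rewrite subn_eq0 eqn_leq kj andbT.
by rewrite -mean_cosM; apply: eq_Rintegral => s _; rewrite natrB.
Qed.

Definition nsq (z : R[i]) : R := complex.Re z ^+ 2 + complex.Im z ^+ 2.

Lemma nsqM : {morph nsq : x y / x * y}.
Proof. by move=> [a b] [c d]; rewrite /nsq /=; ring. Qed.

Lemma nsqX z n : nsq (z ^+ n) = nsq z ^+ n.
Proof.
elim: n => [|n IH]; first by rewrite /nsq /= expr1n expr0n addr0.
by rewrite !exprS nsqM IH.
Qed.

Definition cis (x : R) : R[i] := Complex (cos x) (sin x).

Lemma cisX x n : cis x ^+ n = cis (n%:R * x).
Proof.
elim: n => [|n IH]; first by rewrite mul0r /cis cos0 sin0.
rewrite exprSr IH -natr1 mulrDl mul1r /cis cosD sinD.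
by apply/eqP; rewrite eq_complex /=; apply/andP; split; apply/eqP; ring.
Qed.

(** The base on the left is |b + a e^(ix)|^2, so the left side is the squared modulus of the
    binomial expansion of (b + a e^(ix))^m. *)
Lemma binomial_circleE (a b x : R) (m : nat) :
  (a ^+ 2 + b ^+ 2 + 2 * (a * b) * cos x) ^+ m =
  \sum_(j < m.+1) \sum_(k < m.+1)
    ('C(m, j))%:R * (a ^+ j * b ^+ (m - j)) *
    (('C(m, k))%:R * (a ^+ k * b ^+ (m - k))) * cos ((j%:R - k%:R) * x).
Proof.
pose z : R[i] := real_complex R b + real_complex R a * cis x.
have -> : a ^+ 2 + b ^+ 2 + 2 * (a * b) * cos x = nsq z.
  rewrite /nsq /z /=; have := cos2Dsin2 x => E.
  transitivity (a ^+ 2 * (cos x ^+ 2 + sin x ^+ 2) + b ^+ 2 + 2 * (a * b) * cos x).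
    by rewrite E mulr1.
  by ring.
pose c j := ('C(m, j))%:R * (a ^+ j * b ^+ (m - j)).
have zE : z ^+ m = \sum_(j < m.+1) real_complex R (c j) * cis (j%:R * x).
  rewrite /z exprDn; apply: eq_bigr => j _.
  rewrite exprMn cisX /c -mulr_natl !rmorphM !rmorphXn rmorph_nat /=.
  by rewrite !mulrA; congr (_ * _); rewrite -!mulrA; congr (_ * _); rewrite mulrC.
rewrite -nsqX zE /nsq.
have ReE : complex.Re (\sum_(j < m.+1) real_complex R (c j) * cis (j%:R * x)) =
    \sum_(j < m.+1) c j * cos (j%:R * x).
  by rewrite raddf_sum /=; apply: eq_bigr => j _ /=; ring.
have ImE : complex.Im (\sum_(j < m.+1) real_complex R (c j) * cis (j%:R * x)) =
    \sum_(j < m.+1) c j * sin (j%:R * x).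
  by rewrite raddf_sum /=; apply: eq_bigr => j _ /=; ring.
rewrite ReE ImE !expr2 !big_distrlr /= -big_split /=; apply: eq_bigr => j _.
rewrite -big_split /=; apply: eq_bigr => k _.
by rewrite mulrBl cosB /c; ring.
Qed.

(** By orthogonality only the diagonal of the double sum in [binomial_circleE] survives. *)
Lemma mean_binomial_circle (A B : R) (m : nat) : 0 <= A -> 0 <= B ->
  mean (fun s => (A + B + 2 * Num.sqrt (A * B) * cos (2 * pi * s)) ^+ m) =
  bin_form m A B.
Proof.
move=> A0 B0.
pose a := Num.sqrt A; pose b := Num.sqrt B.
pose c j := ('C(m, j))%:R * (a ^+ j * b ^+ (m - j)).
have cc j k : continuous (fun s : R => c j * c k * cos (2 * pi * ((j%:R - k%:R) * s))).
  move=> s; apply: cvgMr; exact: continuous_cosM.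
transitivity (mean (fun s => \sum_(j < m.+1) \sum_(k < m.+1)
    c j * c k * cos (2 * pi * ((j%:R - k%:R) * s)))).
  apply: eq_Rintegral => s _.
  rewrite sqrtrM// -{1}(sqr_sqrtr A0) -{1}(sqr_sqrtr B0) binomial_circleE.
  apply: eq_bigr => j _; apply: eq_bigr => k _; congr (_ * cos _); ring.
rewrite mean_sum; last by move=> j; exact: continuous_sum_fct.
apply: eq_bigr => j _; rewrite mean_sum; last by move=> k; exact: cc.
rewrite (bigD1 j) //= meanZ ?mean_cosB ?eqxx; last exact: continuous_cosM.
rewrite big1 ?addr0 ?mulr1.
  rewrite /c natrX -[in RHS](sqr_sqrtr A0) -[in RHS](sqr_sqrtr B0).
  by rewrite -!exprM ![(2 * _)%N]mulnC !exprM -/a -/b; ring.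
move=> k kj; rewrite meanZ ?mean_cosB; last exact: continuous_cosM.
by rewrite eq_sym (inj_eq val_inj) (negbTE kj) mulr0.
Qed.

Let g rho (N : nat) s := 1 + rho ^+ 2 + 2 * rho * cos (2 * pi * (N%:R * s)).

Lemma circ_ge rho x : 0 <= rho -> (1 - rho) ^+ 2 <= 1 + rho ^+ 2 + 2 * rho * cos x.
Proof. by move=> r0; have := cos_geN1 x; nra. Qed.

Lemma circ_gt0 rho x : 0 <= rho -> rho < 1 -> 0 < 1 + rho ^+ 2 + 2 * rho * cos x.
Proof.
move=> r0 r1; apply: lt_le_trans (circ_ge x r0).
by rewrite exprn_gt0// subr_gt0.
Qed.

Lemma continuous_ln_circ rho (N : nat) : 0 <= rho -> rho < 1 ->
  continuous (fun s => ln (1 + rho ^+ 2 + 2 * rho * cos (2 * pi * (N%:R * s)))).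
Proof.
move=> r0 r1 s; apply: (@continuous_comp _ _ _ (g rho N) (@ln R)).
  apply: cvgD; first exact: cvg_cst.
  by apply: cvgMr; exact: continuous_cosM.
by apply: continuous_ln; exact: circ_gt0.
Qed.

Let g_per rho N s : g rho N (s + 1) = g rho N s.
Proof. by rewrite /g -[in RHS](cosD2piM _ N); congr (_ + _ * cos _); ring. Qed.

(* [(1 + rho z) (1 - rho z) = 1 - rho^2 z^2], where replacing [z] by [- z] is a
   rotation of the circle. *)
Let mean_ln_doubling rho (N : nat) : 0 <= rho -> rho < 1 -> (0 < N)%N ->
  2 * mean (fun s => ln (g rho N s)) = mean (fun s => ln (g (rho ^+ 2) (2 * N) s)).
Proof.
move=> r0 r1 N0.
have N0' : (N%:R : R) != 0 by rewrite pnatr_eq0 -lt0n.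
have N1 : 1 <= (N%:R : R) by rewrite ler1n.
have cg := @continuous_ln_circ rho N r0 r1.
have r2 : rho ^+ 2 < 1 by rewrite expr_lt1.
have cg2 := @continuous_ln_circ _ (2 * N) (sqr_ge0 rho) r2.
have h1 : 0 <= (2 * N%:R : R)^-1 <= 1.
  by rewrite invr_ge0 mulr_ge0//= invf_le1 ?mulr_gt0//; [lra|rewrite ltr0n].
have h2 : 0 <= (4 * N%:R : R)^-1 <= 1.
  by rewrite invr_ge0 mulr_ge0//= invf_le1 ?mulr_gt0//; [lra|rewrite ltr0n].
(* This shift adds pi to the angle at frequency 2N, and the shift by 1/(2N) below adds pi at
   frequency N. The product of the two factors on the left then equals the factor on the right
   pointwise. *)
rewrite -(mean_shift (h := (4 * N%:R)^-1) cg2)//; last first.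
  by move=> s; congr ln; exact: g_per.
rewrite mulr_natl mulr2n.
rewrite -{2}(mean_shift (h := (2 * N%:R)^-1) cg)//; last first.
  by move=> s; congr ln; exact: g_per.
rewrite -meanD//; last first.
  exact: (continuous_shift_fct (f := fun s => ln (g rho N s))).
apply: eq_Rintegral => s _.
rewrite -lnM ?posrE ?circ_gt0//; congr ln; rewrite /g.
have -> : 2 * pi * (N%:R * (s + (2 * N%:R)^-1)) = 2 * pi * (N%:R * s) + pi by field.
have -> : 2 * pi * ((2 * N)%:R * (s + (4 * N%:R)^-1)) =
    (2 * pi * (N%:R * s)) *+ 2 + pi by rewrite natrM -mulr_natr; field.
rewrite !cosDpi cos_mulr2n.
by ring.
Qed.

(** After k doublings, 2^k times the mean is a mean of the same kind, hence at most ln 4. Since k is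
    arbitrary, the mean cannot be positive. *)
Lemma mean_ln_circ_le0 rho : 0 <= rho -> rho < 1 ->
  mean (fun s => ln (1 + rho ^+ 2 + 2 * rho * cos (2 * pi * s))) <= 0.
Proof.
move=> r0 r1.
have H k : forall rho N, 0 <= rho -> rho < 1 -> (0 < N)%N ->
    2 ^+ k * mean (fun s => ln (g rho N s)) <= ln 4.
  elim: k => [|k IH] x N x0 x1 N0; last first.
    by rewrite exprSr -mulrA mean_ln_doubling// IH ?sqr_ge0 ?expr_lt1// muln_gt0.
  rewrite mul1r -[leRHS]mean_cst; apply: le_mean.
  - exact: continuous_ln_circ.
  - by move=> s; exact: cvg_cst.
  - move=> s; rewrite ler_ln ?posrE ?circ_gt0//.
    by rewrite /g; have := cos_le1 (2 * pi * (N%:R * s)); nra.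
have -> : mean (fun s => ln (1 + rho ^+ 2 + 2 * rho * cos (2 * pi * s))) =
    mean (fun s => ln (g rho 1 s)).
  by apply: eq_Rintegral => s _; rewrite /g mul1r.
set e := mean _; rewrite leNgt; apply/negP => e0.
have l4 : 0 < ln 4 / e by rewrite divr_gt0// ln_gt0// ltr1n.
have := H (Num.bound (ln 4 / e)) rho 1 r0 r1 isT.
rewrite -ler_pdivlMr// leNgt => /negP; apply.
apply: (lt_trans (archi_boundP (ltW l4))).
by rewrite -natrX ltr_nat ltn_expl.
Qed.
End circle.

(** * Comparison of moments by a single crossing *)

Section crossing_integral.
Context {R : realType}.
Implicit Types (A B K X Y c rho : R).

Lemma expR_chord (l w : R) : 0 <= l -> l <= 1 -> expR (l * w) - 1 <= l * (expR w - 1).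
Proof.
move=> l0 l1.
have : expR (l * w + (1 - l) * 0) <= l * expR w + (1 - l) * expR 0.
  by have := @convex_expR R (Itv01 l0 l1) w 0; rewrite !convRE.
by rewrite expR0 mulr0 addr0; lra.
Qed.

(** With G = sqrt (AB), A = G t and B = G / t, the left side is a nonincreasing function of t >= 1,
    equal to the right side at t = 1. The sign of its derivative is [expR_chord] with l = x^(-2) and
    w = G x. *)
Lemma one_sub_expR_geomean A B : 0 <= A -> 0 <= B ->
  (1 - expR (- A)) * (1 - expR (- B)) <= (1 - expR (- Num.sqrt (A * B))) ^+ 2.
Proof.
wlog BA : A B / B <= A => [H A0 B0|].
  have [/H|/ltW /H] := leP B A; first exact.
  by rewrite mulrC [B * A]mulrC; apply.
move=> _; rewrite le_eqVlt => /predU1P[<-|B0].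
  by rewrite oppr0 expR0 subrr mulr0 sqr_ge0.
have A0 : 0 < A by apply: lt_le_trans BA.
pose G := Num.sqrt (A * B); pose t := A / G.
have G0 : 0 < G by rewrite sqrtr_gt0 mulr_gt0.
have GG : G * G = A * B by rewrite -expr2 sqr_sqrtr// ltW// mulr_gt0.
have AE : A = G * t by rewrite /t mulrC divfK// gt_eqF.
have BE : B = G / t.
  rewrite /t invf_div mulrA GG mulrAC divff ?mul1r// gt_eqF//.
have t1 : 1 <= t.
  have GA : G ^+ 2 <= A ^+ 2 by rewrite expr2 GG expr2; apply: ler_wpM2l => //; exact: ltW.
  by rewrite ler_pdivlMr// mul1r -ler_sqr ?nnegrE ?(ltW G0) ?(ltW A0).
rewrite -/G AE BE; move: t1; rewrite le_eqVlt => /predU1P[<-|t1].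
  by rewrite divr1 mulr1 expr2.
pose f (x : R) := (1 - expR (- G * x)) * (1 - expR (- G * x^-1)).
have df x : 1 <= x <= t -> is_derive x 1 f
   (G * expR (- G * x) * (1 - expR (- G * x^-1)) -
    (1 - expR (- G * x)) * (G * x^-1 ^+ 2 * expR (- G * x^-1))).
  move=> /andP[x1 _]; have x0 : x != 0 by rewrite gt_eqF// (lt_le_trans _ x1).
  have d1 := is_derive_sub (is_derive_cst (1 : R) x 1) (is_derive_expM (- G) x).
  have d2 := is_derive_inv (f := id) x0 (is_derive_id x 1).
  have d3 := is_derive_sub (is_derive_cst (1 : R) x 1)
    (is_derive1_comp (is_derive_expM (- G) x^-1) d2).
  apply: (is_derive_eq (is_derive_mul d1 d3)).
  by rewrite /cst /= /GRing.scale /=; field.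
have [x /andP[x1 xt]] := MVT_closed t1 df.
have f1 : f 1 = (1 - expR (- G)) ^+ 2 by rewrite /f invr1 mulr1 expr2.
have ft : f t = (1 - expR (- (G * t))) * (1 - expR (- (G / t))) by rewrite /f !mulNr.
rewrite -f1 -ft => E; rewrite -subr_le0 E mulr_le0_ge0 ?subr_ge0 ?(ltW t1)//.
have x0 : 0 < x by apply: lt_trans x1.
have li : x^-1 ^+ 2 <= 1 by rewrite exprn_ile1 ?invr_ge0 ?invf_le1 ?(ltW x0) ?(ltW x1).
have := expR_chord (G * x) (sqr_ge0 x^-1) li.
have -> : x^-1 ^+ 2 * (G * x) = G * x^-1 by field; rewrite gt_eqF.
rewrite !mulNr !expRN; set u := expR (G * x); set v := expR (G * x^-1) => h.
have u0 : 0 < u by exact: expR_gt0.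
have v0 : 0 < v by exact: expR_gt0.
have -> : G * u^-1 * (1 - v^-1) - (1 - u^-1) * (G * x^-1 ^+ 2 * v^-1) =
  G * u^-1 * v^-1 * ((v - 1) - x^-1 ^+ 2 * (u - 1)).
  by field; rewrite !gt_eqF.
by rewrite mulr_ge0_le0 ?subr_le0// !mulr_ge0 ?invr_ge0 ?ltW.
Qed.

(** The slope of x^m is at most m K^(m-1) on [0, K]. Beyond K it is at least that, so [exprn_sub_ge]
    reaches the same conclusion with X and Y in the opposite order. *)
Lemma exprn_sub_le (m : nat) K X Y : 0 <= Y -> Y <= X -> X <= K ->
  X ^+ m + m%:R * K ^+ m.-1 * Y <= Y ^+ m + m%:R * K ^+ m.-1 * X.
Proof.
move=> Y0 YX XK; have X0 := le_trans Y0 YX.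
suff : X ^+ m - Y ^+ m <= m%:R * K ^+ m.-1 * (X - Y) by lra.
rewrite subrXX mulrC ler_wpM2r ?subr_ge0//.
rewrite mulr_natl -[X in _ *+ X]card_ord -sumr_const; apply: ler_sum => i _.
have im : (m.-1 = (m.-1 - i) + i)%N by have := ltn_ord i; lia.
rewrite [in leRHS]im exprD ler_pM ?exprn_ge0// lerXn2r ?nnegrE//;
  by rewrite ?(le_trans X0)// (le_trans YX).
Qed.

Lemma exprn_sub_ge (m : nat) K X Y : 0 <= K -> K <= X -> X <= Y ->
  X ^+ m + m%:R * K ^+ m.-1 * Y <= Y ^+ m + m%:R * K ^+ m.-1 * X.
Proof.
move=> K0 KX XY; have X0 := le_trans K0 KX.
suff : m%:R * K ^+ m.-1 * (Y - X) <= Y ^+ m - X ^+ m by lra.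
rewrite subrXX mulrC ler_wpM2l ?subr_ge0//.
rewrite mulr_natl -[X in _ *+ X]card_ord -sumr_const; apply: ler_sum => i _.
have im : (m.-1 = (m.-1 - i) + i)%N by have := ltn_ord i; lia.
rewrite [in leLHS]im exprD ler_pM ?exprn_ge0// lerXn2r ?nnegrE//;
  by rewrite ?(le_trans X0)// ?(le_trans KX).
Qed.

Section one_pair.
Context A B rho (m : nat).
Context (A0 : 0 <= A) (B0 : 0 <= B) (r0 : 0 <= rho).
Context (rE : rho ^+ 2 = (1 - expR (- A)) * (1 - expR (- B))).

Let G := Num.sqrt (A * B).
Let X c := A + B + ln (1 + rho ^+ 2 + 2 * rho * c).
Let Y c := A + B + 2 * G * c.

Let rhoG : rho <= 1 - expR (- G).
Proof.
have G0 : 0 <= G by rewrite sqrtr_ge0.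
have e1 : expR (- G) <= 1 by rewrite -[leRHS]expR0 ler_expR oppr_le0.
rewrite -ler_sqr ?nnegrE ?subr_ge0// rE.
exact: one_sub_expR_geomean.
Qed.

Lemma rho_lt1 : rho < 1.
Proof. by apply: le_lt_trans rhoG _; rewrite ltrBlDr ltrDl expR_gt0. Qed.

Let circ0 c : -1 <= c -> 0 < 1 + rho ^+ 2 + 2 * rho * c.
Proof.
move=> c1; apply: (@lt_le_trans _ _ ((1 - rho) ^+ 2)).
  by rewrite exprn_gt0// subr_gt0 rho_lt1.
by move: r0 c1; nra.
Qed.

(** At c = -1 the logarithm is 2 ln (1 - rho), and [rhoG] bounds it below by -2G. *)
Let YX1 : Y (-1) <= X (-1).
Proof.
rewrite /X /Y lerD2l.
have -> : 1 + rho ^+ 2 + 2 * rho * -1 = (1 - rho) ^+ 2 by ring.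
rewrite lnXn ?subr_gt0 ?rho_lt1//.
have : - G <= ln (1 - rho).
  rewrite -[leLHS]expRK ler_ln ?posrE ?expR_gt0 ?subr_gt0 ?rho_lt1//.
  by move: rhoG; lra.
rewrite -mulr_natl; lra.
Qed.

Let X_mono c c' : -1 <= c -> c <= c' -> X c <= X c'.
Proof.
move=> c1 cc; rewrite /X lerD2l ler_ln ?posrE ?circ0//; last exact: le_trans cc.
by rewrite lerD2l ler_wpM2l// mulr_ge0.
Qed.

Let Y_ge0 c : -1 <= c -> 0 <= Y c.
Proof.
move=> c1; have G0 : 0 <= G by rewrite sqrtr_ge0.
apply: (@le_trans _ _ (A + B - 2 * G)); last by rewrite /Y; nra.
have -> : A + B - 2 * G = (Num.sqrt A - Num.sqrt B) ^+ 2.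
  by rewrite sqrrB !sqr_sqrtr// /G sqrtrM// -mulr_natl; ring.
exact: sqr_ge0.
Qed.

Lemma circle_log_ge0 c : -1 <= c -> 0 <= X c.
Proof.
move=> c1; apply: le_trans (X_mono (lexx _) c1).
exact: le_trans (Y_ge0 (lexx _)) YX1.
Qed.

(** [X] is concave and [Y] affine in [c], and c = l c' + (1 - l)(-1), with Y <= X at both ends. *)
Let YX_down c c' : -1 <= c -> c <= c' -> Y c' <= X c' -> Y c <= X c.
Proof.
rewrite le_eqVlt => /predU1P[<- _ _|c1 cc' h]; first exact: YX1.
have d0 : 0 < c' + 1 by move: c1 cc'; lra.
pose l := (c + 1) / (c' + 1).
have l0 : 0 <= l by rewrite divr_ge0 ?(ltW d0)//; move: c1; lra.
have l1 : l <= 1 by rewrite ler_pdivrMr// mul1r lerD2r.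
have cE : c = l * c' + (1 - l) * -1 by rewrite /l; field; rewrite gt_eqF.
have p1 := circ0 (le_trans (ltW c1) cc'); have p2 := circ0 (lexx (-1)).
have : l * ln (1 + rho ^+ 2 + 2 * rho * c') + (1 - l) * ln (1 + rho ^+ 2 + 2 * rho * -1)
    <= ln (l * (1 + rho ^+ 2 + 2 * rho * c') + (1 - l) * (1 + rho ^+ 2 + 2 * rho * -1)).
  by have := @concave_ln R (Itv01 l0 l1) _ _ p1 p2; rewrite !convRE.
have -> : l * (1 + rho ^+ 2 + 2 * rho * c') + (1 - l) * (1 + rho ^+ 2 + 2 * rho * -1) =
  1 + rho ^+ 2 + 2 * rho * c by rewrite [in RHS]cE; ring.
move=> hl; move: YX1 h; rewrite /X /Y !lerD2l => h1 h2.
apply: le_trans hl.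
have -> : 2 * G * c = l * (2 * G * c') + (1 - l) * (2 * G * -1) by rewrite [in LHS]cE; ring.
by rewrite lerD// ler_wpM2l// subr_ge0.
Qed.

(* [X - Y] is concave in [c] and nonnegative at [-1], so the set where it is
   nonnegative is an initial segment of [[-1, 1]]; [K] is the supremum of [X] on
   it. Integrating the inequality shows that the [m]-th moment of [X] is at most
   that of [Y] as soon as the mean of [X] is at most that of [Y]. *)
Let crossing : exists2 K, 0 <= K & forall c, -1 <= c <= 1 ->
  X c ^+ m + m%:R * K ^+ m.-1 * Y c <= Y c ^+ m + m%:R * K ^+ m.-1 * X c.
Proof.
pose S : set R := [set x | exists c, [/\ -1 <= c, c <= 1, Y c <= X c & x = X c]].
have S1 : S (X (-1)) by exists (-1); split => //; lra.
have hS : has_sup S.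
  split; first by exists (X (-1)).
  by exists (X 1) => _ [c [c1 c2 _ ->]]; exact: X_mono.
have K1 := ub_le_sup (proj2 hS) S1.
exists (sup S); first exact: le_trans (circle_log_ge0 (lexx _)) K1.
move=> c /andP[c1 c2]; have [h|h] := leP (Y c) (X c).
  apply: exprn_sub_le => //; first exact: Y_ge0.
  by apply: (ub_le_sup (proj2 hS)); exists c.
apply: exprn_sub_ge; last exact: ltW.
  exact: le_trans (circle_log_ge0 (lexx _)) K1.
apply: sup_le_ub (proj1 hS) _ => _ [c' [c'1 c'2 h' ->]].
have [cc'|/ltW cc'] := leP c c'; last exact: X_mono.
by have := YX_down c1 cc' h'; rewrite leNgt h.
Qed.

Lemma mean_circle_log_pow_le (h : R) : 0 <= h <= 1 ->
  mean (fun s => (A + B + ln (1 + rho ^+ 2 + 2 * rho * cos (2 * pi * (s + h)))) ^+ m)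
  <= bin_form m A B.
Proof.
move=> h01; pose Xs s := X (cos (2 * pi * s)); pose Ys s := Y (cos (2 * pi * s)).
have cc : continuous (fun s : R => cos (2 * pi * s)).
  by have := @continuous_cosM R 1; under eq_fun do rewrite mul1r.
have cX : continuous Xs.
  apply: continuousD_fct; first by move=> s; exact: cvg_cst.
  have := @continuous_ln_circ R rho 1 r0 rho_lt1.
  by under eq_fun do rewrite mul1r.
have cY : continuous Ys.
  apply: continuousD_fct; first by move=> s; exact: cvg_cst.
  by move=> s; apply: cvgMr; exact: cc.
rewrite (mean_shift (f := fun s => Xs s ^+ m)) //; last 2 first.
- exact: continuousX_fct.
- by move=> s; rewrite /Xs mulrDr -(cosD2piM (2 * pi * s) 1).
have [K K0 hK] := crossing.
(* The logarithm has mean at most 0 and the cosine has mean 0, so both sides are compared with A +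
   B. *)
have hm : mean Xs <= mean Ys.
  rewrite /Xs /Ys /X /Y meanD; [|by move=> s; exact: cvg_cst|]; last first.
    have := @continuous_ln_circ R rho 1 r0 rho_lt1.
    by under eq_fun do rewrite mul1r.
  rewrite mean_cst meanD; [|by move=> s; exact: cvg_cst|exact: continuousZ_fct].
  rewrite mean_cst meanZ// lerD2l.
  have := @mean_cosM R 1; under eq_fun do rewrite mul1r.
  move=> ->; rewrite mulr0; exact: mean_ln_circ_le0 rho_lt1.
have : mean (fun s => Xs s ^+ m + m%:R * K ^+ m.-1 * Ys s) <=
       mean (fun s => Ys s ^+ m + m%:R * K ^+ m.-1 * Xs s).
  apply: le_mean; [by apply: continuousD_fct; [exact: continuousX_fct|exact: continuousZ_fct]..|].
  by move=> s; apply: hK; rewrite cos_geN1 cos_le1.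
rewrite meanD; [|exact: continuousX_fct|exact: continuousZ_fct].
rewrite meanD; [|exact: continuousX_fct|exact: continuousZ_fct].
rewrite !meanZ// -(mean_binomial_circle m A0 B0) => H.
have : 0 <= m%:R * K ^+ m.-1 by rewrite mulr_ge0// exprn_ge0.
move=> k0; have := ler_wpM2l k0 hm.
move: H; rewrite -/G.
change (mean (fun s => (A + B + 2 * G * cos (2 * pi * s)) ^+ m))
  with (mean (fun s => Ys s ^+ m)).
by lra.
Qed.
End one_pair.
End crossing_integral.

(** * Products in SU(1,1) *)

Section su11.
Context {R : realType}.
Implicit Types (x y h : R) (z : R[i]) (p q : R[i] * R[i]).

(* The pair (a, b) stands for the matrix [[a, b], [conj b, conj a]]. *)
Definition su_mul p q : R[i] * R[i] :=
  (p.1 * q.1 + p.2 * conjc q.2, p.1 * q.2 + p.2 * conjc q.1).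

Definition su_one : R[i] * R[i] := (1, 0).

Lemma su_mulA : associative su_mul.
Proof.
move=> [a b] [c d] [e f]; rewrite /su_mul /=.
by rewrite !rmorphD !rmorphM /= !conjcK; congr (_, _); ring.
Qed.

Lemma su_mul1 : left_id su_one su_mul.
Proof. by move=> [a b]; rewrite /su_mul /= !mul0r !mul1r !addr0. Qed.

Lemma su_mulr1 : right_id su_one su_mul.
Proof.
move=> [a b]; rewrite /su_mul /su_one; cbn [fst snd].
by rewrite conjc0 conjc1 !mulr0 !mulr1 addr0 add0r.
Qed.

HB.instance Definition _ := Monoid.isLaw.Build (R[i] * R[i])%type su_one su_mul
  su_mulA su_mul1 su_mulr1.

(** Conjugation by the diagonal matrix with entries e^(ix/2) and e^(-ix/2); hence it is
    multiplicative and keeps the determinant. *)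
Definition su_twist x p : R[i] * R[i] := (p.1, cis x * p.2).

Lemma cisD x y : cis (x + y) = cis x * cis y.
Proof.
rewrite /cis cosD sinD; apply/eqP; rewrite eq_complex /=.
by apply/andP; split; apply/eqP; ring.
Qed.

Lemma nsq_cis x : nsq (cis x) = 1.
Proof. by rewrite /nsq /= cos2Dsin2. Qed.

Lemma mul_conjc z : z * conjc z = real_complex R (nsq z).
Proof.
case: z => a b; apply/eqP; rewrite eq_complex /nsq /=.
by apply/andP; split; apply/eqP; ring.
Qed.

Lemma nsq_conjc z : nsq (conjc z) = nsq z.
Proof. by case: z => a b; rewrite /nsq /= sqrrN. Qed.

Lemma cis_mul_conjc x : cis x * conjc (cis x) = 1.
Proof. by rewrite mul_conjc nsq_cis rmorph1. Qed.

Lemma su_twistM x : {morph su_twist x : p q / su_mul p q}.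
Proof.
move=> [a b] [c d]; rewrite /su_twist /su_mul /=; congr (_, _); last by ring.
transitivity (a * c + (cis x * conjc (cis x)) * b * conjc d).
  by rewrite cis_mul_conjc mul1r.
by rewrite rmorphM; ring.
Qed.

Lemma su_twistD x y p : su_twist (x + y) p = su_twist x (su_twist y p).
Proof. by rewrite /su_twist /= cisD mulrA. Qed.

Lemma cis0 : cis (0 : R) = 1.
Proof. by rewrite /cis cos0 sin0. Qed.

Lemma su_twist1 x : su_twist x su_one = su_one.
Proof. by rewrite /su_twist /= mulr0. Qed.

Definition su_det p : R := nsq p.1 - nsq p.2.

Lemma su_detM : {morph su_det : p q / su_mul p q >-> p * q}.
Proof.
by move=> [[a a'] [b b']] [[c c'] [d d']]; rewrite /su_det /su_mul /nsq /=; ring.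
Qed.

Lemma su_det_twist x p : su_det (su_twist x p) = su_det p.
Proof. by rewrite /su_det /= nsqM nsq_cis mul1r. Qed.

Definition su_log p : R := ln (nsq p.1 / su_det p).

Lemma nsq_ge0 z : 0 <= nsq z.
Proof. by rewrite addr_ge0 ?sqr_ge0. Qed.

Lemma nsq_gt0_eq0 z : 0 < nsq z -> z != 0.
Proof. by apply: contraTneq => ->; rewrite /nsq /= expr0n addr0 ltxx. Qed.

Lemma su_det_nsq p : 0 < su_det p -> 0 < nsq p.1.
Proof. by rewrite /su_det subr_gt0; apply: le_lt_trans; exact: nsq_ge0. Qed.

Lemma su_log_ge0 p : 0 < su_det p -> 0 <= su_log p.
Proof.
move=> d0; rewrite ln_ge0// ler_pdivlMr// mul1r /su_det gerBl.
exact: nsq_ge0.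
Qed.

Lemma expR_su_log p : 0 < su_det p -> 1 - expR (- su_log p) = nsq p.2 / nsq p.1.
Proof.
move=> d0; have a0 := su_det_nsq d0.
rewrite expRN lnK ?posrE ?divr_gt0// invf_div /su_det.
by field; rewrite gt_eqF.
Qed.

Lemma su_log_twist x p : su_log (su_twist x p) = su_log p.
Proof. by rewrite /su_log su_det_twist. Qed.

(** The angle is written as -2 pi h with h in [0, 1] so that it becomes a shift covered by
    [mean_shift]. *)
Lemma polar z : exists rho h, [/\ 0 <= rho, 0 <= h <= 1, rho ^+ 2 = nsq z &
  z = real_complex R rho * cis (- (2 * pi * h))].
Proof.
have p0 := pi_gt0 R.
have pc (x : R) : 2 * pi * (x / (2 * pi)) = x.
  by rewrite mulrC divfK// mulf_neq0// gt_eqF.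
have [n0|n0] := eqVneq (nsq z) 0.
  exists 0, 0; rewrite n0 lexx ler01 expr0n; split => //.
  rewrite rmorph0 mul0r; apply: contra_eq n0 => z0.
  case: z z0 => a b; rewrite eq_complex /= negb_and /nsq /= => z0.
  by rewrite paddr_eq0 ?sqr_ge0// !sqrf_eq0 negb_and.
have np : 0 < nsq z by rewrite lt_neqAle eq_sym n0 nsq_ge0.
pose rho := Num.sqrt (nsq z).
have r0 : 0 < rho by rewrite sqrtr_gt0.
have rr : rho ^+ 2 = nsq z by rewrite sqr_sqrtr// ltW.
case: z @rho np n0 rr r0 => a b rho np n0; rewrite {1}/nsq /= => rr r0.
have c1 : -1 <= a / rho <= 1.
  rewrite -ler_norml normrM [`|rho^-1|]ger0_norm ?invr_ge0 ?(ltW r0)//.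
  rewrite ler_pdivrMr// mul1r -[leRHS]ger0_norm ?(ltW r0)//.
  rewrite -ler_sqr ?nnegrE// !real_normK ?num_real//.
  by rewrite rr lerDl sqr_ge0.
have [t0 tp] := andP (proj1 (acos_def c1)); have ct := proj2 (acos_def c1).
have st : sin (acos (a / rho)) = `|b| / rho.
  rewrite sin_acos//; have -> : 1 - (a / rho) ^+ 2 = (`|b| / rho) ^+ 2.
    by rewrite !expr_div_n real_normK ?num_real// rr; field; rewrite -rr expf_neq0// gt_eqF.
  by rewrite sqrtr_sqr ger0_norm// divr_ge0 ?(ltW r0).
(* [acos] only gives angles in [0, pi], so the sign of the imaginary part decides between [h] and
   its reflection 1 - h. *)
have [b0|b0] := leP b 0.
  exists rho, (acos (a / rho) / (2 * pi)); split => //.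
  - exact: ltW.
  - by rewrite divr_ge0 ?mulr_ge0 ?(ltW p0)//= ler_pdivrMr ?mulr_gt0//; lra.
  - rewrite pc /cis cosN sinN ct st (ler0_norm b0).
    apply/eqP; rewrite eq_complex /= !mul0r subr0 addr0; apply/andP; split; apply/eqP;
    by field; rewrite gt_eqF.
exists rho, (1 - acos (a / rho) / (2 * pi)); split => //.
- exact: ltW.
- rewrite subr_ge0 gerBl divr_ge0 ?mulr_ge0 ?(ltW p0)//= ler_pdivrMr ?mulr_gt0//; lra.
- have -> : - (2 * pi * (1 - acos (a / rho) / (2 * pi))) = acos (a / rho) - pi *+ 2.
    by rewrite mulrBr pc mulr1 opprB mulr_natl.
  have -> : cis (acos (a / rho) - pi *+ 2) = cis (acos (a / rho)).
    by rewrite /cis -(cosD2pi (_ - _)) -(sinD2pi (_ - _)) subrK.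
  rewrite /cis ct st (gtr0_norm b0).
  apply/eqP; rewrite eq_complex /= !mul0r subr0 addr0; apply/andP; split; apply/eqP;
  by field; rewrite gt_eqF.
Qed.

(** The upper left entry of the product is p.1 q.1 (1 + z e^(-2 pi i s)) with z = p.2 conj(q.2) /
    (p.1 q.1), and [rho], [h] are the polar data of z. The condition rho < 1 is supplied later by
    [rho_lt1]. *)
Lemma su_log_mul_twist p q : 0 < su_det p -> 0 < su_det q ->
  exists rho h, [/\ 0 <= rho, 0 <= h <= 1,
    rho ^+ 2 = (1 - expR (- su_log p)) * (1 - expR (- su_log q)) &
    rho < 1 -> forall s, su_log (su_mul p (su_twist (2 * pi * s) q)) =
      su_log p + su_log q + ln (1 + rho ^+ 2 + 2 * rho * cos (2 * pi * (s + h)))].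
Proof.
move=> dp dq; have ap := su_det_nsq dp; have aq := su_det_nsq dq.
have zp := nsq_gt0_eq0 ap; have zq := nsq_gt0_eq0 aq.
have [rho [h [r0 h01 rE zE]]] := polar (p.2 * conjc q.2 / (p.1 * q.1)).
have apq : nsq (p.1 * q.1) != 0 by rewrite nsqM mulf_neq0// gt_eqF.
exists rho, h; split => //.
  rewrite rE !expR_su_log//.
  have : nsq (p.2 * conjc q.2 / (p.1 * q.1)) * nsq (p.1 * q.1) = nsq (p.2 * conjc q.2).
    by rewrite -nsqM divfK// mulf_neq0.
  rewrite !nsqM nsq_conjc => E.
  apply: (mulIf apq); rewrite !nsqM E; field.
  by rewrite !gt_eqF.
move=> r1 s; rewrite /su_log su_detM su_det_twist.
have -> : (su_mul p (su_twist (2 * pi * s) q)).1 =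
    (p.1 * q.1) * (1 + real_complex R rho * cis (- (2 * pi * (s + h)))).
  have -> : - (2 * pi * (s + h)) = - (2 * pi * h) + - (2 * pi * s) by ring.
  rewrite cisD mulrA -zE /su_mul /su_twist; cbn [fst snd].
  have -> : conjc (cis (2 * pi * s) * q.2) = cis (- (2 * pi * s)) * conjc q.2.
    by rewrite rmorphM; congr (_ * _); rewrite /cis cosN sinN.
  move: (cis (- (2 * pi * s))) => w.
  by field; rewrite zp zq.
rewrite nsqM nsqM.
have -> : nsq (1 + real_complex R rho * cis (- (2 * pi * (s + h)))) =
    1 + rho ^+ 2 + 2 * rho * cos (2 * pi * (s + h)).
  rewrite /nsq /= cosN sinN; set w := 2 * pi * _.
  transitivity (1 + rho ^+ 2 * (cos w ^+ 2 + sin w ^+ 2) + 2 * rho * cos w);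
    last by rewrite cos2Dsin2 mulr1.
  by ring.
have c0 := circ_gt0 (2 * pi * (s + h)) r0 r1.
have -> : nsq p.1 * nsq q.1 * (1 + rho ^+ 2 + 2 * rho * cos (2 * pi * (s + h))) /
    (su_det p * su_det q) = (nsq p.1 / su_det p) * (nsq q.1 / su_det q) *
    (1 + rho ^+ 2 + 2 * rho * cos (2 * pi * (s + h))).
  by field; rewrite !gt_eqF.
have up : 0 < nsq p.1 / su_det p by rewrite divr_gt0.
have uq : 0 < nsq q.1 / su_det q by rewrite divr_gt0.
by rewrite lnM ?posrE ?(mulr_gt0 up uq)// lnM ?posrE.
Qed.

Lemma integral_pair_le (m : nat) (n0 n1 : R) p q : (2 <= m)%N ->
  0 < su_det p -> 0 < su_det q -> 0 <= n0 -> 0 <= n1 ->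
  (n0 = 0 -> su_log p = 0) -> (n1 = 0 -> su_log q = 0) ->
  (\int[uniform_prob (@ltr01 R)]_s ((n0 + n1) `^ (1 - kappa m) *
      su_log (su_mul p (su_twist (2 * pi * s) q)) ^+ m)%:E <=
   (n0 `^ (1 - kappa m) * su_log p ^+ m + n1 `^ (1 - kappa m) * su_log q ^+ m)%:E)%E.
Proof.
move=> m2 dp dq n00 n10 np nq.
have A0 := su_log_ge0 dp; have B0 := su_log_ge0 dq.
have [rho [h [r0 h01 rE uE]]] := su_log_mul_twist dp dq.
have r1 := rho_lt1 A0 B0 r0 rE.
pose f s := (su_log p + su_log q + ln (1 + rho ^+ 2 + 2 * rho * cos (2 * pi * (s + h)))) ^+ m.
have cf : continuous f.
  have c0 := @continuous_ln_circ R rho 1 r0 r1.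
  have c1 : continuous (fun s : R => ln (1 + rho ^+ 2 + 2 * rho * cos (2 * pi * s))).
    by move: c0; under eq_fun do rewrite mul1r.
  have c2 := continuousD_fct (@cst_continuous _ _ (su_log p + su_log q))
    (continuous_shift_fct (h := h) c1).
  exact: continuousX_fct c2.
rewrite (_ : (fun s => _) = (fun s => ((n0 + n1) `^ (1 - kappa m) * f s)%:E)); last first.
  by apply/funext => s; rewrite (uE r1).
have f0 s : 0 <= f s.
  by rewrite exprn_ge0//; apply: (circle_log_ge0 A0 B0 r0 rE); exact: cos_geN1.
rewrite mean_uniform.
- rewrite lee_fin meanZ//.
  apply: (le_trans (ler_wpM2l (powR_ge0 _ _) (mean_circle_log_pow_le m A0 B0 r0 rE h01))).
  exact: two_point_weighted.
- by move=> s; apply: cvgMr; exact: cf.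
- by move=> s; rewrite mulr_ge0// powR_ge0.
Qed.
End su11.

(** * Binary words in lexicographic order *)

Section words.

Fixpoint words (n : nat) : seq (seq bool) :=
  if n is n'.+1 then map (cons false) (words n') ++ map (cons true) (words n')
  else [:: [::]].

(** The definition branches on the first bit, whereas merging pairs neighbours that differ in the
    last one. *)
Lemma words_rcons n :
  words n.+1 = flatten [seq [:: rcons w false; rcons w true] | w <- words n].
Proof.
elim: n => [//|n IH].
rewrite -[LHS]/(map (cons false) (words n.+1) ++ map (cons true) (words n.+1)).
rewrite {1 2}IH !map_flatten -!map_comp -flatten_cat /= map_cat -!map_comp.
by [].
Qed.

Lemma mem_words n w : (w \in words n) = (size w == n).
Proof.
elim: n w => [|n IH] [|b w] //=.
- by rewrite mem_cat; apply/negP => /orP[] /mapP[].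
- have inj c : injective (cons c : seq bool -> _) by move=> x y [].
  rewrite mem_cat eqSS -IH; case: b; rewrite (mem_map (inj _)).
    by rewrite orbC; case: (_ \in _) => //=; apply/mapP => -[].
  by case: (_ \in _) => //=; apply/mapP => -[].
Qed.

End words.

(** * The ordered product as a binary tree *)

Section tree.
Context {R : realType}.
Implicit Types (w : seq bool) (F : seq bool -> R[i] * R[i]) (n : seq bool -> R).

(** The word is reversed, as in [pairing]: its last bit meets the first coordinate of [t]. *)
Definition phase d w (t : d.-tuple R) : R :=
  \sum_(i < d) (nth false (rev w) i : nat)%:R * tnth t i.

Definition tree_prod d F (t : d.-tuple R) : R[i] * R[i] :=
  \big[@su_mul R/@su_one R]_(w <- words d) su_twist (2 * pi * phase w t) (F w).

Definition tree_merge F (s : R) w : R[i] * R[i] :=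
  su_mul (F (rcons w false)) (su_twist (2 * pi * s) (F (rcons w true))).

Lemma phase_rcons d w b (s : R) (t : d.-tuple R) :
  phase (rcons w b) (tcons (s, t)) = (b : nat)%:R * s + phase w t.
Proof.
rewrite /phase big_ord_recl rev_rcons /= /tcons /=; congr (_ + _).
by apply: eq_bigr => i _; rewrite tnthS.
Qed.

(** Two sibling words share the phase of their common prefix, and since [su_twist] is multiplicative
    this phase can be taken out of the merged pair. *)
Lemma tree_prodS d F (s : R) (t : d.-tuple R) :
  tree_prod F (tcons (s, t)) = tree_prod (tree_merge F s) t.
Proof.
rewrite /tree_prod words_rcons big_flatten big_map; apply: eq_bigr => w _.
rewrite big_cons big_seq1 !phase_rcons mul0r mul1r add0r /tree_merge su_twistM.
by rewrite -su_twistD -mulrDr [s + _]addrC.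
Qed.

Lemma sum_tree_merge d n : \sum_(w <- words d.+1) n w =
  \sum_(w <- words d) (n (rcons w false) + n (rcons w true)).
Proof.
rewrite words_rcons big_flatten big_map; apply: eq_bigr => w _.
by rewrite big_cons big_seq1.
Qed.

Lemma su_det_tree_prod d F (t : d.-tuple R) :
  (forall w, 0 < su_det (F w)) -> 0 < su_det (tree_prod F t).
Proof.
move=> F0; rewrite /tree_prod; elim: (words d) => [|w r IH].
  by rewrite big_nil /su_det /nsq /= expr1n !expr0n /= !addr0 subr0.
by rewrite big_cons su_detM su_det_twist mulr_gt0.
Qed.

Lemma su_det_tree_merge F (s : R) w :
  (forall w, 0 < su_det (F w)) -> 0 < su_det (tree_merge F s w).
Proof. by move=> F0; rewrite /tree_merge su_detM su_det_twist mulr_gt0. Qed.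

(** A zero logarithm forces rho = 0, so merging adds nothing. This carries the condition on nodes
    without points up the tree. *)
Lemma su_log_tree_merge0 F (s : R) w : (forall w, 0 < su_det (F w)) ->
  su_log (F (rcons w false)) = 0 -> su_log (F (rcons w true)) = 0 ->
  su_log (tree_merge F s w) = 0.
Proof.
move=> F0 p0 q0.
have [rho [h [_ _ + E]]] := su_log_mul_twist (F0 (rcons w false)) (F0 (rcons w true)).
rewrite p0 oppr0 expR0 subrr mul0r => /eqP; rewrite sqrf_eq0 => /eqP r0.
rewrite /tree_merge E ?r0 ?ltr01// p0 q0 expr0n /= mulr0 mul0r !addr0.
by rewrite ln1 addr0.
Qed.

(** * Measurability of the products and their logarithms *)

Section measurability.
Context d (T : measurableType d).
Implicit Types (f g : T -> R[i]) (p q : T -> R[i] * R[i]).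

Definition cmeasurable f :=
  measurable_fun setT (fun x => complex.Re (f x) : R) /\
  measurable_fun setT (fun x => complex.Im (f x) : R).

Definition su_measurable p := cmeasurable (fst \o p) /\ cmeasurable (snd \o p).

Lemma cmeasurableD f g : cmeasurable f -> cmeasurable g ->
  cmeasurable (fun x => f x + g x).
Proof.
move=> [f1 f2] [g1 g2]; split.
  rewrite (_ : (fun x => _) = fun x => complex.Re (f x) + complex.Re (g x)).
    exact: measurable_funD.
  by apply/funext => x; case: (f x) (g x) => ? ? [].
rewrite (_ : (fun x => _) = fun x => complex.Im (f x) + complex.Im (g x)).
  exact: measurable_funD.
by apply/funext => x; case: (f x) (g x) => ? ? [].
Qed.

Lemma cmeasurableM f g : cmeasurable f -> cmeasurable g ->
  cmeasurable (fun x => f x * g x).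
Proof.
move=> [f1 f2] [g1 g2]; split.
  rewrite (_ : (fun x => _) = fun x => complex.Re (f x) * complex.Re (g x) -
    complex.Im (f x) * complex.Im (g x)).
    by apply: measurable_funB; exact: measurable_funM.
  by apply/funext => x; case: (f x) (g x) => ? ? [].
rewrite (_ : (fun x => _) = fun x => complex.Re (f x) * complex.Im (g x) +
    complex.Im (f x) * complex.Re (g x)).
  by apply: measurable_funD; exact: measurable_funM.
by apply/funext => x; case: (f x) (g x) => ? ? [].
Qed.

Lemma cmeasurable_conj f : cmeasurable f -> cmeasurable (fun x => conjc (f x)).
Proof.
move=> [f1 f2]; split.
  rewrite (_ : (fun x => _) = fun x => complex.Re (f x))//.
  by apply/funext => x; case: (f x).
rewrite (_ : (fun x => _) = fun x => - complex.Im (f x)).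
  exact: measurable_funN.
by apply/funext => x; case: (f x).
Qed.

Lemma cmeasurable_cis (g : T -> R) : measurable_fun setT g ->
  cmeasurable (fun x => cis (g x)).
Proof.
move=> mg; split => /=.
  by apply: measurableT_comp mg; apply: continuous_measurable_fun; exact: continuous_cos.
by apply: measurableT_comp mg; apply: continuous_measurable_fun; exact: continuous_sin.
Qed.

Lemma cmeasurable_cst (c : R[i]) : cmeasurable (fun=> c).
Proof. by split; exact: measurable_cst. Qed.

Lemma su_measurableM p q : su_measurable p -> su_measurable q ->
  su_measurable (fun x => su_mul (p x) (q x)).
Proof.
move=> [p1 p2] [q1 q2]; split.
  exact: cmeasurableD (cmeasurableM p1 q1) (cmeasurableM p2 (cmeasurable_conj q2)).
exact: cmeasurableD (cmeasurableM p1 q2) (cmeasurableM p2 (cmeasurable_conj q1)).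
Qed.

Lemma su_measurable_twist (g : T -> R) p : measurable_fun setT g ->
  su_measurable p -> su_measurable (fun x => su_twist (g x) (p x)).
Proof.
move=> mg [p1 p2]; split => //.
exact: cmeasurableM (cmeasurable_cis mg) p2.
Qed.

Lemma su_measurable_prod (I : Type) (r : seq I) (p : I -> T -> R[i] * R[i]) :
  (forall i, su_measurable (p i)) ->
  su_measurable (fun x => \big[@su_mul R/@su_one R]_(i <- r) p i x).
Proof.
move=> mp; elim: r => [|i r IH].
  by under eq_fun do rewrite big_nil; split; exact: cmeasurable_cst.
rewrite (_ : (fun x => _) =
  fun x => su_mul (p i x) (\big[@su_mul R/@su_one R]_(i <- r) p i x)).
  exact: su_measurableM.
by apply/funext => x; rewrite big_cons.
Qed.

Lemma measurable_nsq f : cmeasurable f -> measurable_fun setT (fun x => nsq (f x)).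
Proof. by move=> [f1 f2]; apply: measurable_funD; exact: measurable_funX. Qed.

Lemma measurable_su_log p : su_measurable p -> (forall x, 0 < su_det (p x)) ->
  measurable_fun setT (fun x => su_log (p x)).
Proof.
move=> [p1 p2] d0.
rewrite (_ : (fun x => _) = fun x => ln (nsq (p x).1) - ln (su_det (p x))).
  apply: measurable_funB; apply: measurableT_comp => //.
    exact: measurable_nsq.
  by apply: measurable_funB; exact: measurable_nsq.
by apply/funext => x; rewrite /su_log ln_div// posrE// su_det_nsq.
Qed.

Lemma su_measurable_tree_prod k (F : seq bool -> T -> R[i] * R[i])
    (t : T -> k.-tuple (measurableTypeR R)) :
  (forall w, su_measurable (F w)) -> measurable_fun setT t ->
  su_measurable (fun x => tree_prod (F ^~ x) (t x)).
Proof.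
move=> mF mt; apply: su_measurable_prod => w; apply: su_measurable_twist => //.
apply: measurable_funM; first exact: measurable_cst.
apply: measurable_sum => i; apply: measurable_funM; first exact: measurable_cst.
by have /measurable_fun_tnthP := mt; exact.
Qed.

End measurability.

Lemma measurable_tree_term d (T : measurableType d) k (F : seq bool -> T -> R[i] * R[i])
    (t : T -> k.-tuple (measurableTypeR R)) (c : R) m :
  (forall w, su_measurable (F w)) -> (forall w x, 0 < su_det (F w x)) ->
  measurable_fun setT t ->
  measurable_fun setT (fun x => (c * su_log (tree_prod (F ^~ x) (t x)) ^+ m)%:E).
Proof.
move=> mF F0 mt; apply/measurable_EFinP; apply: measurable_funM.
  exact: measurable_cst.
apply: measurable_funX; apply: measurable_su_log.
  exact: su_measurable_tree_prod.
by move=> x; exact: su_det_tree_prod.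
Qed.

Lemma integral_torusS d (f : d.+1.-tuple (measurableTypeR R) -> \bar R) :
  measurable_fun setT f -> (forall t, 0 <= f t)%E ->
  (\int[torus_measure R d.+1]_t f t =
   \int[uniform_prob (@ltr01 R)]_s \int[torus_measure R d]_t f (tcons (s, t)))%E.
Proof.
move=> mf f0; rewrite /= ge0_integral_distribution// fubini_tonelli1//.
  by apply: measurableT_comp => //; exact: measurable_tcons.
by move=> x; exact: f0.
Qed.

(* The induction peels off the first coordinate of the torus, which is paired with
   the least significant bit: it merges the leaves two by two. *)
Lemma integral_tree_le (m d : nat) F n : (2 <= m)%N ->
  (forall w, 0 < su_det (F w)) -> (forall w, 0 <= n w) ->
  (forall w, n w = 0 -> su_log (F w) = 0) ->
  (\int[torus_measure R d]_t ((\sum_(w <- words d) n w) `^ (1 - kappa m) *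
      su_log (tree_prod F t) ^+ m)%:E <=
   (\sum_(w <- words d) n w `^ (1 - kappa m) * su_log (F w) ^+ m)%:E)%E.
Proof.
move=> m2; elim: d F n => [|d IH] F n F0 n0 nF.
  rewrite /= integral_dirac//; last first.
    by apply: (measurable_tree_term (F := fun w _ => F w) (t := id)) => // w;
      split; exact: cmeasurable_cst.
  rewrite diracT mul1e lee_fin !big_seq1 /tree_prod big_seq1 su_log_twist.
  exact: lexx.
have mm : forall w, su_measurable (fun s : measurableTypeR R => tree_merge F s w).
  move=> w; apply: su_measurableM; first by split; exact: cmeasurable_cst.
  apply: su_measurable_twist; last by split; exact: cmeasurable_cst.
  by apply: measurable_funM => //; exact: measurable_cst.
rewrite integral_torusS; last 2 first.
- by apply: (measurable_tree_term (F := fun w _ => F w) (t := id)) => // w;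
    split; exact: cmeasurable_cst.
- move=> t; rewrite lee_fin mulr_ge0 ?powR_ge0// exprn_ge0// su_log_ge0//.
  exact: su_det_tree_prod.
pose n' w := n (rcons w false) + n (rcons w true).
pose H w s : R := n' w `^ (1 - kappa m) * su_log (tree_merge F s w) ^+ m.
have H0 w s : 0 <= H w s.
  by rewrite mulr_ge0 ?powR_ge0// exprn_ge0// su_log_ge0// su_det_tree_merge.
have mH w : measurable_fun setT (fun s : measurableTypeR R => (H w s)%:E).
  apply/measurable_EFinP; apply: measurable_funM; first exact: measurable_cst.
  apply: measurable_funX; apply: measurable_su_log => // s.
  exact: su_det_tree_merge.
have n'0 w : n' w = 0 -> n (rcons w false) = 0 /\ n (rcons w true) = 0.
  by move/eqP; rewrite paddr_eq0// => /andP[/eqP ? /eqP].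
(* For fixed [s], the induction hypothesis for the merged leaves bounds the inner integral;
   [integral_pair_le] then integrates each merged leaf over [s]. *)
apply: (@le_trans _ _ (\int[uniform_prob (@ltr01 R)]_s (\sum_(w <- words d) (H w s)%:E))%E).
  apply: ge0_le_integral => //.
  - move=> s _; apply: integral_ge0 => t _.
    rewrite lee_fin mulr_ge0 ?powR_ge0// exprn_ge0// su_log_ge0//.
    exact: su_det_tree_prod.
  - apply: (@measurable_fun_fubini_tonelli_F _ _ _ _ _ (torus_measure R d)
      (fun x => ((\sum_(w <- words d.+1) n w) `^ (1 - kappa m) *
                  su_log (tree_prod F (tcons x)) ^+ m)%:E)) => //.
    + apply: (@measurable_tree_term _ _ d.+1 (fun w _ => F w) (@tcons R d)) => //.
    + move=> x; rewrite lee_fin mulr_ge0 ?powR_ge0// exprn_ge0// su_log_ge0//.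
      exact: su_det_tree_prod.
  - exact: emeasurable_sum.
  - move=> s _; rewrite sumEFin.
    under eq_integral do rewrite tree_prodS.
    rewrite sum_tree_merge; apply: (IH (tree_merge F s) n') => w.
    + exact: su_det_tree_merge.
    + by rewrite addr_ge0.
    + by move=> /n'0[h1 h2]; apply: su_log_tree_merge0 => //; exact: nF.
rewrite ge0_integral_sum//; last by move=> w s _; rewrite lee_fin.
rewrite sum_tree_merge -sumEFin; apply: lee_sum => w _.
by apply: integral_pair_le => //; exact: nF.
Qed.
End tree.

(** * The transform as an ordered product *)

Section subsequences.
Context {T : eqType}.
Implicit Types (x : T) (s l : seq T) (n : nat).

Fixpoint subs n s : seq (seq T) :=
  match n, s with
  | 0, _ => [:: [::]]
  | _.+1, [::] => [::]
  | n'.+1, x :: s' => map (cons x) (subs n' s') ++ subs n s'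
  end.

Lemma mem_subs n s l : uniq s -> (l \in subs n s) = subseq l s && (size l == n).
Proof.
elim: s n l => [|x s IH] [|n] [|y l] //=; rewrite ?sub0seq// ?andbF// => /andP[xs us].
  by rewrite mem_cat IH// sub0seq /= orbF; apply/negP => /mapP[].
rewrite mem_cat IH// eqSS; have [->|yx] := eqVneq y x.
  rewrite mem_map; last by move=> ? ? [].
  rewrite IH// orbC; case: (boolP (subseq (x :: l) s)) => //= /mem_subseq/(_ x).
  by rewrite mem_head => /(_ isT) xs'; rewrite xs' in xs.
suff -> : (y :: l \in [seq x :: i | i <- subs n s]) = false by [].
by apply/mapP => -[z _ [yE _]]; rewrite yE eqxx in yx.
Qed.

Lemma uniq_subs n s : uniq s -> uniq (subs n s).
Proof.
elim: s n => [|x s IH] [|n] //= /andP[xs us].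
rewrite cat_uniq; apply/and3P; split; last exact: IH.
  by rewrite map_inj_uniq ?IH// => ? ? [].
apply/hasPn => l; rewrite mem_subs// => /andP[ls _].
apply/mapP => -[l' _ E]; move: ls; rewrite E => /mem_subseq/(_ x).
by rewrite mem_head => /(_ isT) xs'; rewrite xs' in xs.
Qed.

End subsequences.

(** A strictly sorted list is determined by its elements, so [l] is [s] filtered by membership in
    [l]. *)
Lemma sorted_subseqE (disp : Order.disp_t) (T : orderType disp) (s l : seq T) :
  sorted <%O s -> all (fun x => x \in s) l && sorted <%O l = subseq l s.
Proof.
move=> ss; apply/andP/idP => [[/allP ls sl]|sub].
  rewrite (_ : l = [seq x <- s | x \in l]) ?filter_subseq//.
  apply: lt_sorted_eq => //; first by apply: sorted_filter => //; exact: lt_trans.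
  by move=> x; rewrite mem_filter; case: (boolP (x \in l)) => //= /ls ->.
split; last by apply: subseq_sorted sub ss; exact: lt_trans.
by apply/allP => x xl; exact: (mem_subseq sub).
Qed.

(** Replaces the increasing tuples counted by [Ncount] with subsequences, over which recursion on
    [s] is possible. *)
Lemma big_sorted_tuples (disp : Order.disp_t) (T : finOrderType disp) (V : nmodType)
    (s : seq T) n (f : seq T -> V) : sorted <%O s ->
  \sum_(w : n.-tuple T | all (fun x => x \in s) w && sorted <%O w) f w = \sum_(l <- subs n s) f l.
Proof.
move=> ss; have us : uniq s := lt_sorted_uniq ss.
transitivity (\sum_(l <- [seq val w | w <- enum {: n.-tuple T}] |
    all (fun x => x \in s) l && sorted <%O l) f l).
  by rewrite big_map big_enum_cond.
rewrite -big_filter.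
apply: perm_big; apply: uniq_perm; last first.
- move=> l; rewrite mem_filter sorted_subseqE// mem_subs//; congr (_ && _).
  apply/mapP/eqP => [[w _ ->]|ln]; first by rewrite size_tuple.
  by exists (Tuple (introT eqP ln)); rewrite ?mem_enum.
- exact: uniq_subs.
- by rewrite filter_uniq// map_inj_uniq ?enum_uniq//; exact: val_inj.
Qed.

Lemma sorted_words n : sorted <%O (words n : seq (seqlexi bool)).
Proof.
rewrite lt_sorted_pairwise; elim: n => [//|n IH].
have tailE (b : bool) (u v : seqlexi bool) : ((b :: u : seqlexi bool) < b :: v)%O = (u < v)%O.
  by rewrite ltxi_cons lexx.
rewrite /= pairwise_cat !pairwise_map; apply/and3P; split.
- by apply/allrelP => _ _ /mapP[u _ ->] /mapP[v _ ->]; rewrite neqhead_ltxiE.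
- by apply: sub_pairwise IH => u v /=; rewrite tailE.
- by apply: sub_pairwise IH => u v /=; rewrite tailE.
Qed.

Lemma filter_words d (s : seq (cube d)) : sorted <%O s ->
  [seq w <- words d | w \in map val s] = map val s.
Proof.
move=> ss; apply: (@lt_sorted_eq _ (seqlexi bool)).
- by apply: sorted_filter; [exact: lt_trans|exact: sorted_words].
- by rewrite sorted_map.
move=> w; rewrite mem_filter; case: (boolP (w \in map val s)) => //= ws.
have [x _ ->] := mapP ws; rewrite mem_words size_tuple; exact: eqxx.
Qed.

Section transform.
Context {R : realType}.
Local Notation C := (R[i]).

Section alternating.
Context {T : eqType} (y : T -> C).
Implicit Types (x : T) (s l : seq T).

(* Conjugating the tail makes the factors alternate:
   [alt_prod [:: a; b; c]] is [y a * conj (y b) * y c]. *)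
Fixpoint alt_prod l : C := if l is x :: l' then y x * conjc (alt_prod l') else 1.

Context (r : R).

Let term n s : C := (r ^+ n)%:C%C * \sum_(l <- subs n s) alt_prod l.

Let term0 s : term 0 s = 1.
Proof. by rewrite /term; case: s => [|x s] /=; rewrite big_seq1 mulr1. Qed.

Let termS0 n : term n.+1 [::] = 0.
Proof. by rewrite /term big_nil mulr0. Qed.

Let conj_term n s :
  conjc (term n s) = (r ^+ n)%:C%C * \sum_(l <- subs n s) conjc (alt_prod l).
Proof.
by rewrite /term rmorphM; congr (_ * _); [exact: conjc_real|exact: rmorph_sum].
Qed.

Let termS n x s : term n.+1 (x :: s) =
  r%:C%C * y x * conjc (term n s) + term n.+1 s.
Proof.
rewrite conj_term /term /= big_cat big_map /= mulrDr; congr (_ + _).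
by rewrite -mulr_sumr exprS rmorphM; ring.
Qed.

Let leaf x : C * C := (1, r%:C%C * y x).

(** Subsequences of even length build the upper left entry of the product, those of odd length
    ([od]) the upper right one. *)
Let ev N s := \sum_(n < N.+1) (if odd n then 0 else term n s).
Let od N s := \sum_(n < N.+1) (if odd n then term n s else 0).

Let ev_cons N x s : ev N.+1 (x :: s) = ev N.+1 s + r%:C%C * y x * conjc (od N s).
Proof.
rewrite /ev /od ![\sum_(_ < N.+2) _]big_ord_recl ![if odd ord0 then _ else _]/=.
rewrite !term0 -addrA; congr (_ + _).
rewrite rmorph_sum mulr_sumr -big_split; apply: eq_bigr => i _.
rewrite lift0 oddS !if_neg; case: (odd i); first by rewrite termS addrC.
by rewrite rmorph0 mulr0 /= addr0.
Qed.

Let od_cons N x s : od N.+1 (x :: s) = od N.+1 s + r%:C%C * y x * conjc (ev N s).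
Proof.
rewrite /ev /od ![\sum_(_ < N.+2) _]big_ord_recl ![if odd ord0 then _ else _]/= !add0r.
rewrite rmorph_sum mulr_sumr -big_split; apply: eq_bigr => i _.
rewrite lift0 oddS !if_neg; case: (odd i); last by rewrite termS addrC.
by rewrite rmorph0 mulr0 /= addr0.
Qed.

(** A subsequence of [x :: s] either omits [x] or starts with it; the latter conjugates the rest and
    flips the parity of the length, exactly as left multiplication by the matrix of [x] does. *)
Lemma alt_prod_su N s : (size s <= N)%N ->
  (ev N s, od N s) = \big[@su_mul R/@su_one R]_(x <- s) leaf x.
Proof.
elim: s N => [|x s IH] N sN.
  rewrite big_nil /ev /od !big_ord_recl /= term0 !big1 ?addr0// => i _;
  by rewrite /bump leq0n add1n termS0 if_same.
case: N sN => [//|N]; rewrite ltnS => sN.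
rewrite big_cons ev_cons od_cons /leaf.
(* The cutoff already reaches the length of [s], so raising it adds nothing. *)
have [-> ->] : ev N.+1 s = ev N s /\ od N.+1 s = od N s.
  by have := IH N.+1 (leqW sN); rewrite -(IH N sN) => -[].
by rewrite -(IH N sN) /su_mul /= !mul1r.
Qed.

Lemma sum_even_terms K s : (size s <= K.*2.+1)%N ->
  \sum_(k < K.+1) (r ^+ (2 * k))%:C%C * (\sum_(l <- subs (2 * k) s) alt_prod l) =
  (\big[@su_mul R/@su_one R]_(x <- s) leaf x).1.
Proof.
move=> sK; rewrite -(alt_prod_su sK) /= /ev -/(K.+1.*2).
elim: (K.+1) => [|k IH]; first by rewrite !big_ord0.
by rewrite doubleS !big_ord_recr /= -IH /= odd_double /= addr0 mul2n.
Qed.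
End alternating.

Context {d : nat}.
Implicit Types (t : d.-tuple R) (x : cube d) (l : seq (cube d)) (E : {set cube d}).

Lemma pairingD (u v : 'rV[int]_d) t : pairing (u + v) t = pairing u t + pairing v t.
Proof.
rewrite /pairing -big_split; apply: eq_bigr => j _ /=.
by rewrite mxE rmorphD mulrDl.
Qed.

Lemma pairingN (u : 'rV[int]_d) t : pairing (- u) t = - pairing u t.
Proof.
rewrite /pairing -sumrN; apply: eq_bigr => j _ /=.
by rewrite mxE rmorphN mulNr.
Qed.

Lemma altsum_cons n x (w : n.-tuple (cube d)) :
  altsum [tuple of x :: w] = - cube_vec x - altsum w.
Proof.
rewrite /altsum big_ord_recl expr1 scaleN1r; congr (_ + _).
rewrite -sumrN; apply: eq_bigr => i _.
by rewrite lift0 tnthS exprS mulN1r scaleNr.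
Qed.

Lemma expm2piE (v : R) : expm2pi v = cis (- (2 * pi * v)).
Proof. by rewrite /expm2pi /cis cosN sinN. Qed.

Definition character t x : C := cis (2 * pi * pairing (cube_vec x) t).

(** The minus sign of the first term of [altsum] cancels the one in [expm2pi], so the first factor
    is not conjugated. *)
Lemma expm2pi_altsum n (w : n.-tuple (cube d)) t :
  expm2pi (pairing (altsum w) t) = alt_prod (character t) w.
Proof.
elim: n w => [|n IH] w.
  rewrite tuple0 /altsum big_ord0 /= expm2piE.
  by rewrite (_ : pairing 0 t = 0) ?mulr0 ?oppr0 ?cis0// /pairing big1// => j _; rewrite mxE mul0r.
case/tupleP: w => x w; rewrite altsum_cons pairingD !pairingN /= -IH !expm2piE.
rewrite -opprD mulrN opprK mulrDr cisD; congr (_ * _).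
by rewrite /cis cosN sinN /= opprK.
Qed.

Lemma phase_pairing x t : pairing (cube_vec x) t = phase (x : seq bool) t.
Proof.
rewrite /pairing /phase (reindex_inj rev_ord_inj); apply: eq_bigr => i _ /=.
rewrite rev_ordK mxE nth_rev ?size_tuple// (tnth_nth false) /=.
by rewrite pmulrn.
Qed.

Lemma mu_transform_sum E r t : mu_transform E r t =
  \sum_(k < (#|E| %/ 2).+1) (r ^+ (2 * k))%:C%C *
    \sum_(w : (2 * k).-tuple (cube d) | all (fun x => x \in E) w && sorted <%O w)
      expm2pi (pairing (altsum w) t).
Proof.
(* A finite list containing every alternating sum that occurs; [mucoef] vanishes outside it, which
   makes the sum over Z^d finite. *)
pose X : seq 'rV[int]_d := undup (flatten
  [seq [seq altsum w | w <- enum {: (2 * (k : 'I_(#|E| %/ 2).+1)).-tuple (cube d)}]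
  | k <- enum 'I_(#|E| %/ 2).+1]).
have inX (k : 'I_(#|E| %/ 2).+1) (w : (2 * k).-tuple (cube d)) : altsum w \in X.
  rewrite mem_undup; apply/flattenP.
  exists [seq altsum w | w <- enum {: (2 * k).-tuple (cube d)}].
    by apply: map_f; rewrite mem_enum.
  by apply: map_f; rewrite mem_enum.
have muE xi : (mucoef E r xi)%:C%C = \sum_(k < (#|E| %/ 2).+1) (r ^+ (2 * k))%:C%C *
    \sum_(w : (2 * k).-tuple (cube d) | all (fun x => x \in E) w && sorted <%O w)
      (altsum w == xi)%:R.
  rewrite /mucoef rmorph_sum; apply: eq_bigr => k _ /=.
  rewrite rmorphM rmorph_nat; congr (_ * _).
  rewrite /Ncount -sum1_card natr_sum big_mkcond [RHS]big_mkcond.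
  apply: eq_bigr => w _; rewrite inE andbA.
  by case: (altsum w == xi); rewrite ?andbT ?andbF; case: (_ && _).
rewrite /mu_transform -(fsbig_widen [set` X] setT) //=; last first.
  move=> xi [_ /= /negP xiX]; rewrite muE big1 ?mul0r// => k _.
  rewrite big1 ?mulr0// => w _.
  by case: eqP => // wxi; rewrite -wxi inX in xiX.
rewrite -fsbig_seq ?undup_uniq//.
under eq_bigr do rewrite muE mulr_suml.
rewrite exchange_big; apply: eq_bigr => k _ /=.
under eq_bigr do rewrite -mulrA mulr_suml.
rewrite -mulr_sumr exchange_big; congr (_ * _); apply: eq_bigr => w _ /=.
rewrite (bigD1_seq (altsum w)) ?undup_uniq//= eqxx mul1r big1 ?addr0// => xi xiw.
by rewrite eq_sym (negbTE xiw) mul0r.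
Qed.

(** Words outside E receive the identity, so that the product over E runs over a full binary tree;
    the phases are left to [su_twist]. *)
Definition cube_leaf E (r : R) (w : seq bool) : C * C :=
  if w \in [seq val x | x <- enum E] then (1, r%:C%C) else su_one.

Lemma mu_transform_tree E r t : mu_transform E r t = (tree_prod (cube_leaf E r) t).1.
Proof.
pose s : seq (cube d) := sort <=%O (enum E).
have ss : sorted <%O s by rewrite sort_lt_sorted enum_uniq.
have sE x : (x \in s) = (x \in E) by rewrite mem_sort mem_enum.
have sz : size s = #|E| by rewrite size_sort cardE.
transitivity (\big[@su_mul R/@su_one R]_(x <- s) (1, r%:C%C * character t x)).1.
  rewrite -(@sum_even_terms _ (character t) r (#|E| %/ 2)); last first.
    by rewrite sz; lia.
  rewrite mu_transform_sum; apply: eq_bigr => k _; congr (_ * _).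
  rewrite -(big_sorted_tuples _ _ ss); apply: eq_big => w.
    by congr (_ && _); apply: eq_all => x; rewrite sE.
  by move=> _; exact: expm2pi_altsum.
congr fst; rewrite /tree_prod.
transitivity (\big[@su_mul R/@su_one R]_(w <- map val s)
    su_twist (2 * pi * phase w t) (1, r%:C%C)).
  rewrite big_map; apply: eq_bigr => x _.
  by rewrite /su_twist /character phase_pairing mulrC.
rewrite -(filter_words ss) big_filter big_mkcond; apply: eq_bigr => w _.
rewrite /cube_leaf (_ : (w \in map val (enum E)) = (w \in map val s)).
  by case: ifP => // _; rewrite su_twist1.
by apply/mapP/mapP => -[x xE ->]; exists x => //; move: xE; rewrite mem_enum sE.
Qed.
End transform.

(** * The moment bound *)

Section assembly.
Context {R : realType} {d : nat} (E : {set cube d}) (r : R).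
Context (r0 : 0 <= r) (r1 : r < 1).

Let L : R := ln (1 / (1 - r ^+ 2)).
Let F := cube_leaf E r.
Let inE' w := w \in [seq val x | x <- enum E].

Let r2 : 0 < 1 - r ^+ 2.
Proof. by rewrite subr_gt0 expr_lt1. Qed.

Let nsq1 : nsq (1 : R[i]) = 1. Proof. by rewrite /nsq /= expr1n expr0n addr0. Qed.
Let nsq0 : nsq (0 : R[i]) = 0. Proof. by rewrite /nsq /= expr0n addr0. Qed.

Lemma su_det_cube_leaf w : su_det (F w) = if inE' w then 1 - r ^+ 2 else 1.
Proof.
rewrite /F /cube_leaf -/(inE' w); case: (inE' w); rewrite /su_det /= nsq1.
  by rewrite /nsq /= expr0n addr0.
by rewrite nsq0 subr0.
Qed.

Let detF_gt0 w : 0 < su_det (F w).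
Proof. by rewrite su_det_cube_leaf; case: ifP. Qed.

Lemma su_log_cube_leaf w : su_log (F w) = (inE' w : nat)%:R * L.
Proof.
rewrite /su_log su_det_cube_leaf /F /cube_leaf -/(inE' w).
by case: (inE' w); rewrite /= nsq1; [rewrite [RHS]mul1r|rewrite divr1 ln1 mul0r].
Qed.

Let count_words : \sum_(w <- words d) (inE' w : nat)%:R = #|E|%:R :> R.
Proof.
rewrite -natr_sum -sum1_card; congr (_%:R).
pose s : seq (cube d) := sort <=%O (enum E).
have ss : sorted <%O s by rewrite sort_lt_sorted enum_uniq.
have inE's w : inE' w = (w \in map val s).
  by apply/mapP/mapP => -[x xE ->]; exists x => //; move: xE; rewrite mem_sort.
transitivity (\sum_(w <- words d | w \in map val s) 1)%N.
  by rewrite [RHS]big_mkcond; apply: eq_bigr => w _; rewrite inE's; case: (_ \in _).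
rewrite -big_filter filter_words// sum1_size size_map size_sort -cardE.
by rewrite sum1_card.
Qed.

Let prod_const (c : R) : \prod_(w <- words d) (if inE' w then c else 1) = c ^+ #|E|.
Proof.
have -> : #|E| = (\sum_(w <- words d) inE' w)%N.
  by apply/eqP; rewrite -(eqr_nat R) -count_words natr_sum.
elim: (words d) => [|w s IH]; first by rewrite !big_nil.
by rewrite !big_cons IH exprD; case: (inE' w); rewrite ?expr1 ?expr0.
Qed.

Lemma su_det_tree t : su_det (tree_prod (d := d) F t) = (1 - r ^+ 2) ^+ #|E|.
Proof.
rewrite -prod_const /tree_prod.
rewrite (big_morph _ (@su_detM R) (_ : su_det su_one = 1)); last first.
  by rewrite /su_det /= nsq1 nsq0 subr0.
by apply: eq_bigr => w _; rewrite su_det_twist su_det_cube_leaf.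
Qed.

(** The operator norm of the matrix represented by [p], its largest singular value being |a| +
    |b|. *)
Definition su_norm (p : R[i] * R[i]) : R := Normc.normc p.1 + Normc.normc p.2.

Lemma normc_sqr (z : R[i]) : Normc.normc z ^+ 2 = nsq z.
Proof. by case: z => a b; rewrite /= sqr_sqrtr// addr_ge0 ?sqr_ge0. Qed.

Lemma normc_ge0 (z : R[i]) : 0 <= Normc.normc z.
Proof. by case: z => a b; exact: sqrtr_ge0. Qed.

Lemma normc_conjc (z : R[i]) : Normc.normc (conjc z) = Normc.normc z.
Proof. by case: z => a b; rewrite /= sqrrN. Qed.

Lemma su_normM p q : su_norm (su_mul p q) <= su_norm p * su_norm q.
Proof.
rewrite /su_norm /su_mul /=.
apply: (le_trans (lerD (le_normcD _ _) (le_normcD _ _))).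
by rewrite !Normc.normcM !normc_conjc le_eqVlt; apply/orP; left; apply/eqP; ring.
Qed.

Lemma su_norm_tree t : su_norm (tree_prod (d := d) F t) <= (1 + r) ^+ #|E|.
Proof.
rewrite -prod_const /tree_prod.
elim: (words d) => [|w s IH].
  by rewrite !big_nil /su_norm /su_one; cbn [fst snd]; rewrite Normc.normc1 Normc.normc0 addr0.
rewrite !big_cons; apply: (le_trans (su_normM _ _)); apply: ler_pM => //.
- by rewrite addr_ge0 ?normc_ge0.
- by rewrite addr_ge0 ?normc_ge0.
rewrite /su_norm /su_twist /F /cube_leaf -/(inE' w); cbn [fst snd].
rewrite Normc.normcM (_ : Normc.normc (cis _) = 1) ?mul1r.
  case: (inE' w); cbn [fst snd]; rewrite Normc.normc1 ?Normc.normc0 ?addr0// lerD2l.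
  by rewrite /= expr0n addr0 sqrtr_sqr ger0_norm.
by rewrite /cis /= cos2Dsin2 sqrtr1.
Qed.

Let q : R := ((1 + r) / (1 - r)) ^+ #|E|.

(** The norm bound gives |a|^2 <= (1+r)^(2|E|); dividing by the determinant (1-r^2)^|E| leaves
    [q]. *)
Lemma su_log_tree_le t : su_log (tree_prod (d := d) F t) <= ln q.
Proof.
have det0 := su_det_tree_prod t detF_gt0.
have r1' : 0 < 1 - r by rewrite subr_gt0.
have r1p : 0 < 1 + r by rewrite ltr_wpDr.
have q0 : 0 < q by rewrite exprn_gt0// divr_gt0.
rewrite /su_log ler_ln ?posrE ?divr_gt0 ?su_det_nsq//.
rewrite ler_pdivrMr// su_det_tree /q.
have -> : ((1 + r) / (1 - r)) ^+ #|E| * (1 - r ^+ 2) ^+ #|E| = ((1 + r) ^+ #|E|) ^+ 2.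
  rewrite -exprMn -exprM mulnC exprM; congr (_ ^+ _).
  by field; rewrite gt_eqF.
rewrite -normc_sqr lerXn2r ?nnegrE ?normc_ge0 ?exprn_ge0 ?(ltW r1p)//.
by apply: le_trans (su_norm_tree t); rewrite lerDl normc_ge0.
Qed.

(** On [0, ln Q] the exponential lies below its chord. If ln Q = 0, then u = 0 and both sides
    vanish. *)
Lemma expR_quot_le (u Q : R) : 1 <= Q -> 0 <= u -> u <= ln Q ->
  expR u - 1 <= quot01 (Q - 1) (ln Q) * u.
Proof.
move=> Q1 u0 uQ; have Q0 : 0 < Q by apply: lt_le_trans Q1.
have [l0|l0] := eqVneq (ln Q) 0.
  have -> : u = 0 by apply/eqP; rewrite eq_le u0 andbT -l0.
  by rewrite expR0 subrr mulr0.
have lp : 0 < ln Q by rewrite lt_neqAle eq_sym l0 (le_trans u0).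
rewrite /quot01 (negbTE l0) andbF.
have h0 : 0 <= u / ln Q by rewrite divr_ge0// ltW.
have h1 : u / ln Q <= 1 by rewrite ler_pdivrMr// mul1r.
have := expR_chord (ln Q) h0 h1; rewrite divfK// lnK ?posrE// => h.
by rewrite (_ : (Q - 1) / ln Q * u = u / ln Q * (Q - 1)) //; ring.
Qed.

Lemma integral_mu_le (m : nat) : (2 <= m)%N ->
  (\int[torus_measure R d]_t
     ((Normc.normc (mu_transform E r t) ^+ 2 - (1 - r ^+ 2) ^+ #|E|) ^+ m)%:E
   <= (Cconst m #|E| r * #|E|%:R `^ kappa m)%:E)%E.
Proof.
move=> m2.
pose u (t : d.-tuple (measurableTypeR R)) : R := su_log (tree_prod F t).
have det0 t := su_det_tree_prod (d := d) t detF_gt0.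
have u0 t : 0 <= u t by exact: su_log_ge0.
have uq t : u t <= ln q by exact: su_log_tree_le.
have r1' : 0 < 1 - r by rewrite subr_gt0.
have q1 : 1 <= q.
  by rewrite exprn_ege1// ler_pdivlMr// mul1r lerD2l (le_trans _ r0)// oppr_le0.
pose Q := quot01 (q - 1) (ln q).
have Q0 : 0 <= Q.
  by rewrite /Q /quot01; case: ifP => // _; rewrite divr_ge0 ?subr_ge0 ?ln_ge0.
have L0 : 0 <= L by rewrite ln_ge0// ler_pdivlMr// mul1r gerBl sqr_ge0.
have fE t : (Normc.normc (mu_transform E r t) ^+ 2 - (1 - r ^+ 2) ^+ #|E|) ^+ m =
    (1 - r ^+ 2) ^+ (m * #|E|) * (expR (u t) - 1) ^+ m.
  rewrite normc_sqr mu_transform_tree mulnC exprM -exprMn; congr (_ ^+ _).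
  rewrite -(su_det_tree t) /u /su_log lnK ?posrE ?divr_gt0 ?su_det_nsq//.
  by field; rewrite gt_eqF.
under eq_integral do rewrite fE.
have mu : measurable_fun setT u.
  apply: measurable_su_log => //.
  by apply: (su_measurable_tree_prod (F := fun w _ => F w) (t := id)).
set c := (1 - r ^+ 2) ^+ (m * #|E|).
have c0 : 0 <= c by rewrite exprn_ge0// ltW.
have CE : Cconst m #|E| r = c * (Q * L) ^+ m by [].
have e0 t : 0 <= expR (u t) - 1 by rewrite subr_ge0 -[leLHS]expR0 ler_expR.
(* For empty E the integrand is zero. Otherwise |E| > 0 and its powers with exponents kappa - 1 and
   1 - kappa are inverse to each other. *)
have [E0|E0] := posnP #|E|.
  have C0 : 0 <= Cconst m #|E| r by rewrite CE mulr_ge0// exprn_ge0// mulr_ge0.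
  rewrite [leLHS]integral0_eq ?lee_fin ?(mulr_ge0 C0 (powR_ge0 _ _))// => t _.
  have -> : u t = 0.
    by apply/eqP; rewrite eq_le u0 andbT (le_trans (uq t))// /q E0 ln1.
  by rewrite expR0 subrr expr0n gtn_eqF ?mulr0//; lia.
pose N : R := #|E|%:R.
have N0 : 0 < N by rewrite ltr0n.
(* The last factor compensates the weight in [g], so that K g = c (Q u)^m. *)
pose K := c * Q ^+ m * N `^ (kappa m - 1).
have K0 : 0 <= K by exact: mulr_ge0 (mulr_ge0 c0 (exprn_ge0 m Q0)) (powR_ge0 _ _).
pose g t := N `^ (1 - kappa m) * u t ^+ m.
have g0 t : 0 <= g t by rewrite mulr_ge0 ?powR_ge0 ?exprn_ge0.
have mg : measurable_fun setT g.
  by apply: measurable_funM; [exact: measurable_cst|exact: measurable_funX].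
apply: (@le_trans _ _ (\int[torus_measure R d]_t (K%:E * (g t)%:E))%E).
  apply: ge0_le_integral => //.
  - by move=> t _; rewrite lee_fin mulr_ge0// exprn_ge0.
  - apply/measurable_EFinP; apply: measurable_funM; first exact: measurable_cst.
    apply: measurable_funX; apply: measurable_funB; last exact: measurable_cst.
    exact: measurableT_comp mu.
  - by apply: measurable_funeM; exact/measurable_EFinP.
  - move=> t _; rewrite -EFinM lee_fin /K /g.
    have -> : c * Q ^+ m * N `^ (kappa m - 1) * (N `^ (1 - kappa m) * u t ^+ m) =
        c * (Q * u t) ^+ m.
      rewrite -[1 - kappa m]opprB powRN exprMn; field.
      by rewrite gt_eqF// powR_gt0.
    rewrite ler_wpM2l// lerXn2r ?nnegrE ?mulr_ge0//.
    exact: expR_quot_le.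
rewrite ge0_integralZl_EFin//; last 2 first.
- by move=> t _; rewrite lee_fin.
- exact/measurable_EFinP.
have := @integral_tree_le R m d F (fun w => (inE' w : nat)%:R) m2 detF_gt0
  (fun w => ler0n _ _).
rewrite count_words -/N => H.
(* With weights 0 and 1 on the leaves, each point of E contributes L^m to the tree bound and every
   other word contributes 0. *)
have {}H : (\int[torus_measure R d]_t (g t)%:E <= (N * L ^+ m)%:E)%E.
  apply: (le_trans (H _)); first by move=> w w0; rewrite su_log_cube_leaf w0 mul0r.
  rewrite lee_fin /N -count_words mulr_suml; apply: ler_sum => w _.
  rewrite su_log_cube_leaf; case: (inE' w); first by rewrite powR1 !mul1r.
  by rewrite !mul0r expr0n gtn_eqF ?mulr0//; lia.
apply: (@le_trans _ _ (K%:E * (N * L ^+ m)%:E)%E); first by rewrite lee_wpmul2l ?lee_fin.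
rewrite -EFinM lee_fin CE /K le_eqVlt; apply/orP; left; apply/eqP.
have -> : N `^ kappa m = N * N `^ (kappa m - 1).
  by rewrite mulr_powRB1 ?(ltW N0)// (lt_trans ltr01)// kappa_gt1.
by rewrite exprMn; ring.
Qed.
End assembly.

Theorem corollary12 (R : realType) (m d : nat) (E : {set cube d}) (r : R)
  (hm : (2 <= m)%N) (hd : (1 <= d)%N) (hr0 : 0 <= r) (hr1 : r < 1) :
  (\int[torus_measure R d]_t
     ((Normc.normc (mu_transform E r t) ^+ 2
        - (1 - r ^+ 2) ^+ #|E|) ^+ m)%:E
   <= (Cconst m #|E| r * #|E|%:R `^ ((2 * m)%:R / pexp R m))%:E)%E.
Proof.
have -> : (2 * m)%:R / pexp R m = kappa m; last exact: integral_mu_le.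
rewrite /pexp /log2 -/(kappa m) invf_div mulrCA divff ?mulr1// pnatr_eq0 muln_eq0.
by apply/eqP; lia.
Qed.
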